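(* There exists an absolute constant $K<\infty$ for which the following holds. Let $\eta\in(0,1]$ and $\varepsilon\ge 0$. Let $(A,B,C)$ be an $\eta$-strictly admissible ordered triple of Lebesgue measurable subsets of $\mathbb{R}^1$ with finite, positive Lebesgue measures. If $$\langle \mathbf{1}_A*\mathbf{1}_B,\,\mathbf{1}_{C}\rangle \ge \langle \mathbf{1}_{A^\star}*\mathbf{1}_{B^\star},\,\mathbf{1}_{C^\star}\rangle -\varepsilon \max(|A|,|B|,|C|)^2$$ and if $\varepsilon \le K^{-1} \eta^{4}$, then there exist intervals $I,J,L\subset\mathbb{R}$ such that $$|A\bigtriangleup I| \le K\eta^{-1}\varepsilon^{1/2}\max(|A|,|B|,|C|),$$ $$|B\bigtriangleup J| \le K\eta^{-1}\varepsilon^{1/2}\max(|A|,|B|,|C|),$$ $$|C\bigtriangleup L| \le K\eta^{-1}\varepsilon^{1/2}\max(|A|,|B|,|C|),$$ and the centers $a,b,c$ of $I,J,L$ (respectively) satisfy $$|a+b-c|\le K\eta^{-2}\varepsilon^{1/4} \max(|A|,|B|,|C|).$$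
   Context: $|A|$ denotes Lebesgue measure of $A\subset\mathbb{R}$, $\mathbf{1}_A$ the indicator function of $A$, and $\langle f,g\rangle=\int_{\mathbb{R}} fg\,dm$ with $m$ Lebesgue measure; $*$ is convolution on $\mathbb{R}$. For a measurable set $S$ with $0<|S|<\infty$, $S^\star$ is the open interval centered at $0$ with $|S^\star|=|S|$. $S\bigtriangleup T$ is the symmetric difference. For $\eta\in(0,1]$, an ordered triple $(A_1,A_2,A_3)$ of measurable subsets of $\mathbb{R}^1$ with $0<|A_j|<\infty$ is $\eta$-strictly admissible if $|A_i|+|A_j|\ge |A_k|+\eta\max(|A_1|,|A_2|,|A_3|)$ for every permutation $(i,j,k)$ of $(1,2,3)$. *)

(* Defs.v *)
From mathcomp Require Import all_boot all_order all_algebra.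
From mathcomp Require Import all_classical all_reals all_analysis.

Set Implicit Arguments.
Unset Strict Implicit.
Unset Printing Implicit Defensive.

Import Order.TTheory GRing.Theory Num.Theory.
Import numFieldNormedType.Exports.

Local Open Scope classical_set_scope.
Local Open Scope ring_scope.

(* Sets are Lebesgue measurable, not merely Borel, so all measures and integrals
   are taken with respect to [completed_lebesgue_measure], whose sigma-algebra is
   that of the Caratheodory-measurable sets of the Lebesgue outer measure. *)
Definition lebesgue_measurable {R : realType} (A : set R) : Prop :=
  ((wlength (idfun : R -> R))^*)%mu.-cara.-measurable A.

Definition leb {R : realType} (A : set R) : \bar R :=
  completed_lebesgue_measure A.

(* [fine] sends +oo to 0: meaningful only when [leb A < +oo]. *)
Definition rleb {R : realType} (A : set R) : R := fine (leb A).

Definition convolution {R : realType} (f g : R -> R) (x : R) : R :=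
  \int[completed_lebesgue_measure]_y (f (x - (y : R)) * g y).

Definition pairing {R : realType} (f g : R -> R) : R :=
  \int[completed_lebesgue_measure]_x (f x * g x).

Definition sym_interval {R : realType} (A : set R) : set R :=
  `] - (rleb A / 2), rleb A / 2 [%classic.

Definition max_rleb {R : realType} (A B C : set R) : R :=
  Num.max (rleb A) (Num.max (rleb B) (rleb C)).

Definition strictly_admissible {R : realType} (eta : R)
    (A1 A2 A3 : set R) : Prop :=
  let A := tnth [tuple A1; A2; A3] in
  forall i j k : 'I_3, uniq [:: i; j; k] ->
    rleb (A k) + eta * max_rleb A1 A2 A3 <= rleb (A i) + rleb (A j).

(* [has_inf] and [has_sup] make the interval nonempty and bounded, so that it
   has a center. *)
Definition bounded_interval {R : realType} (I : set R) : Prop :=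
  [/\ is_interval I, has_inf I & has_sup I].

Definition interval_center {R : realType} (I : set R) : R := (inf I + sup I) / 2.

(* Main.v *)
Require Import Defs.
From mathcomp Require Import all_boot all_order all_algebra.
From mathcomp Require Import all_classical all_reals all_analysis.
From mathcomp Require Import measurable_realfun ring lra zify.

Set Implicit Arguments.
Unset Strict Implicit.
Unset Printing Implicit Defensive.

Import Order.TTheory GRing.Theory Num.Theory.
Import numFieldNormedType.Exports.

Local Open Scope classical_set_scope.
Local Open Scope ring_scope.

(** Stability of the one-dimensional Riesz-Sobolev inequality. Write
    [T (A, B, C)] for [<1_A * 1_B, 1_C>] and [a], [b], [c] for the lengths.

    The inequality itself follows from one observation. Remove from [A] its
    leftmost and from [B] its rightmost part of length [s]. For each [z], both
    removed parts affect only the left end of [A] intersected with [z - B], so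
    that [1_A * 1_B] decreases by at most [s] everywhere; the same holds with
    left and right exchanged. If the total amount removed is
    [t = (a + b - c) / 2], the trimmed sets have lengths adding up to [c], and
    [T (A, B, C) <= t c + (a - t) (b - t) = a b - t ^ 2], which is the value
    for centered intervals ([tri_trim], [tri_centered_intervals]). In the case
    of near equality, all trimmed pairs [A'], [B'] satisfy
    [T (A', B', C) >= |A'| |B'| - d ^ 2], where [d] is [eps ^ (1 / 2)] times
    the largest length: almost all sums of [A'] and [B'] lie in [C], although
    [C] is only as long as [A'] and [B'] together. Strict admissibility
    ensures that the trimmed sets are not too short, and since the form is
    symmetric up to reflections one may trim [A] and [C] afterwards and so
    move a window of [A] of length comparable to [eta] to any place
    ([window_with_small_sumset]).

    Thus suppose that almost all sums of [E] and [F] lie in a set [G] of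
    length [|E| + |F|]. There are points [x0 < x1] of [E] and [y0 < y1] of
    [F], with only [O(d)] of these sets outside them, whose translates of the
    other set lie in [G] up to [O(d)]. With [x0 = y0 = 0], [p = x1] and
    [q = y1], the set [G] is almost the disjoint union of [F] and [q + E], and
    also of [E] and [p + F]. If [p <= q], and otherwise with [E] and [F]
    exchanged, this forces [F] to continue [E] periodically with period [p],
    and [E] is almost closed under addition modulo [p]
    ([full_of_endpoint_translates]). On the circle of circumference [p], a
    rotation then moves either almost nothing or almost all of [E] into [E]:
    if the overlap is not negligible, the rotation is a difference of two
    typical elements of [E]. The overlap depends continuously on the rotation,
    so the second alternative holds for all rotations, and averaging shows
    that [E] almost fills the circle ([almost_closed_fills_circle]). Hence
    [E], if it is not longer than [F], is an interval up to [O(d)]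
    ([near_interval_of_sums]).

    Consequently a window of [A] away from the ends of [A] has holes of total
    length [O(d)] ([few_local_holes]). About [1 / eta] windows cover [A],
    which is therefore an interval up to [O(d / eta)] ([few_holes],
    [near_interval_of_few_holes]); by symmetry so are [B] and [C]. Finally,
    pairs of points near the left ends of trimmed sets have sums near the sum
    of these ends, and almost all such sums lie in [C]. This bounds the left
    end of [C] in terms of those of [A] and [B] ([left_ends_align]); the same
    statement for the triple [(C, - B, A)] is the opposite inequality, and
    together they locate the centers. *)

(** * Lengths of Borel sets *)

Section Length.
Context {R : realType}.
Implicit Types A B C D X Y : set R.
Local Notation mu := (@lebesgue_measure R).

(** Borel sets of finite length. Their length is kept as a real number, so that
    linear arithmetic applies to it. *)
Definition fborel A : Prop := measurable A /\ (mu A < +oo)%E.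

Definition len A : R := fine (mu A).

Lemma len_ge0 A : 0 <= len A.
Proof. by rewrite /len fine_ge0. Qed.

Lemma lenE A : fborel A -> mu A = (len A)%:E.
Proof. by move=> [_ fA]; rewrite /len fineK// ge0_fin_numE. Qed.

Lemma fborel_sub A B : measurable A -> fborel B -> A `<=` B -> fborel A.
Proof.
move=> mA [mB fB] AB; split=> //.
by rewrite (le_lt_trans _ fB)// le_measure ?inE.
Qed.

Lemma fborelIl A X : fborel A -> measurable X -> fborel (A `&` X).
Proof.
move=> fA mX; apply: (fborel_sub _ fA); last by move=> x [].
by apply: measurableI => //; exact: fA.1.
Qed.

Lemma fborelIr A X : fborel A -> measurable X -> fborel (X `&` A).
Proof. by rewrite setIC; exact: fborelIl. Qed.

Lemma fborelD A X : fborel A -> measurable X -> fborel (A `\` X).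
Proof.
move=> fA mX; apply: (fborel_sub _ fA); last by move=> x [].
by apply: measurableD => //; exact: fA.1.
Qed.

Lemma fborelU A B : fborel A -> fborel B -> fborel (A `|` B).
Proof.
move=> [mA fA] [mB fB]; split; first exact: measurableU.
by rewrite (le_lt_trans (measureU2 _ _ _))// lte_add_pinfty.
Qed.

Lemma le_len A B : measurable A -> fborel B -> A `<=` B -> len A <= len B.
Proof.
move=> mA fB AB; have fA := fborel_sub mA fB AB.
by rewrite -lee_fin -!lenE// le_measure// inE //; exact: fB.1.
Qed.

Lemma lenID A X : fborel A -> measurable X ->
  len A = len (A `&` X) + len (A `\` X).
Proof.
move=> fA mX; apply: EFin_inj.
rewrite EFinD -!lenE//; [|exact: fborelD|exact: fborelIl].
by rewrite addeC -measureDI//; exact: fA.1.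
Qed.

Lemma lenU_le A B : fborel A -> fborel B -> len (A `|` B) <= len A + len B.
Proof.
move=> fA fB; rewrite -lee_fin EFinD -!lenE//; last exact: fborelU.
by apply: measureU2; [exact: fA.1|exact: fB.1].
Qed.

Lemma lenU A B : fborel A -> fborel B -> A `&` B `<=` set0 ->
  len (A `|` B) = len A + len B.
Proof.
move=> fA fB AB; apply: EFin_inj.
rewrite EFinD -!lenE//; last exact: fborelU.
by rewrite measureU//; [exact: fA.1|exact: fB.1|rewrite -subset0].
Qed.

Lemma len_cover A B C : measurable A -> fborel B -> fborel C ->
  A `<=` B `|` C -> len A <= len B + len C.
Proof.
move=> mA fB fC ABC; apply: le_trans (lenU_le fB fC).
by apply: le_len ABC => //; exact: fborelU.
Qed.

Lemma len0 : len set0 = 0.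
Proof. by rewrite /len measure0. Qed.

Lemma len_gt0_nonempty A : 0 < len A -> exists x, A x.
Proof.
move=> A0; apply/set0P/eqP => A_0; by move: A0; rewrite A_0 len0 ltxx.
Qed.

Lemma measurable_shift A c : measurable A -> measurable [set x : R | A (x + c)].
Proof.
move=> mA; rewrite -[X in measurable X]setTI.
have : measurable_fun setT (fun x : R => x + c).
  by apply: measurable_funD => //; exact: measurable_cst.
exact.
Qed.

Lemma measurable_opp A : measurable A -> measurable [set x : R | A (- x)].
Proof.
move=> mA; rewrite -[X in measurable X]setTI.
have : measurable_fun setT (fun x : R => - x) by exact: oppr_measurable.
exact.
Qed.

Lemma lebesgue_shift A c : measurable A -> mu [set x | A (x + c)] = mu A.
Proof.
move=> mA; apply/esym.
have mf : measurable_fun [set: measurableTypeR R]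
    (fun x : measurableTypeR R => (x + c : measurableTypeR R)).
  by apply: measurable_funD => //; exact: measurable_cst.
pose nu := pushforward (@lebesgue_measure R)
  (fun x : measurableTypeR R => (x + c : measurableTypeR R)).
pose nuM : {measure set (measurableTypeR R) -> \bar R} :=
  measure_function_pushforward__canonical__measure_function_Measure mu mf.
rewrite (@lebesgue_measure_unique R nuM)//.
move=> _ [[a b] _ <-].
rewrite /nuM /= /pushforward.
have -> : (fun x : R => x + c) @^-1` `]a, b] = `]a - c, b - c]%classic.
  by apply/seteqP; split=> x /=; rewrite !in_itv/= ltrBlDr lerBrDr.
rewrite !lebesgue_measure_itv /= !lte_fin ltrD2r.
by case: ifP => // _; rewrite -!EFinB; congr EFin; ring.
Qed.

Lemma lebesgue_opp A : measurable A -> mu [set x | A (- x)] = mu A.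
Proof.
move=> mA; apply/esym.
have mf : measurable_fun [set: measurableTypeR R]
    (fun x : measurableTypeR R => (- x : measurableTypeR R)).
  exact: oppr_measurable.
pose nuM : {measure set (measurableTypeR R) -> \bar R} :=
  measure_function_pushforward__canonical__measure_function_Measure mu mf.
rewrite (@lebesgue_measure_unique R nuM)//.
move=> _ [[a b] _ <-].
rewrite /nuM /= /pushforward.
have -> : (fun x : R => - x) @^-1` `]a, b] = `[- b, - a[%classic.
  by apply/seteqP; split=> x /=; rewrite !in_itv/= lerNl ltrNr andbC.
rewrite !lebesgue_measure_itv /= !lte_fin ltrN2.
by case: ifP => // _; rewrite -!EFinB; congr EFin; ring.
Qed.

Lemma fborel_shift A c : fborel A -> fborel [set x | A (x + c)].
Proof.
by move=> [mA fA]; split; [exact: measurable_shift|rewrite lebesgue_shift].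
Qed.

Lemma fborel_opp A : fborel A -> fborel [set x | A (- x)].
Proof.
by move=> [mA fA]; split; [exact: measurable_opp|rewrite lebesgue_opp].
Qed.

Lemma len_shift A c : measurable A -> len [set x | A (x + c)] = len A.
Proof. by move=> mA; rewrite /len lebesgue_shift. Qed.

Lemma len_opp A : measurable A -> len [set x | A (- x)] = len A.
Proof. by move=> mA; rewrite /len lebesgue_opp. Qed.

Lemma fborel_reflect A c : fborel A -> fborel [set x | A (c - x)].
Proof.
move=> fA; rewrite (_ : mkset _ = [set x | A (- (x + - c))]).
  exact: (fborel_shift (- c) (fborel_opp fA)).
by apply/seteqP; split=> x /=; rewrite opprD opprK addrC.
Qed.

Lemma measurable_reflect A c : measurable A -> measurable [set x | A (c - x)].
Proof.
move=> fA; rewrite (_ : mkset _ = [set x | A (- (x + - c))]).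
  exact: (measurable_shift (- c) (measurable_opp fA)).
by apply/seteqP; split=> x /=; rewrite opprD opprK addrC.
Qed.

Lemma lebesgue_reflect A c : measurable A -> mu [set x | A (c - x)] = mu A.
Proof.
move=> mA; rewrite (_ : mkset _ = [set x | A (- (x + - c))]).
  by rewrite (lebesgue_shift (- c) (measurable_opp mA)) lebesgue_opp.
by apply/seteqP; split=> x /=; rewrite opprD opprK addrC.
Qed.

Lemma len_reflect A c : measurable A -> len [set x | A (c - x)] = len A.
Proof. by move=> mA; rewrite /len lebesgue_reflect. Qed.

Lemma len_itv (b0 b1 : bool) (a b : R) : a <= b ->
  len [set` Interval (BSide b0 a) (BSide b1 b)] = b - a.
Proof.
move=> ab; rewrite /len lebesgue_measure_itv/= lte_fin.
by move: ab; rewrite le_eqVlt => /predU1P[->|->]; rewrite ?ltxx ?subrr// -EFinB.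
Qed.

Lemma fborel_itv (b0 b1 : bool) (a b : R) :
  fborel [set` Interval (BSide b0 a) (BSide b1 b)].
Proof.
split; first exact: measurable_itv.
by rewrite lebesgue_measure_itv/=; case: ifP; rewrite ?ltry.
Qed.

(** * Cutting a set at a prescribed length *)

(** Initial segments of the line; unlike half-lines they include the empty set
    and the whole line, so that a set can be cut at any length between [0] and
    its own. *)
Definition initial D : Prop := forall x y, y <= x -> D x -> D y.

Lemma initial_measurable D : initial D -> measurable D.
Proof.
move=> iD; apply: is_interval_measurable => x y Dx Dy z /andP[_ zy].
exact: iD Dy.
Qed.

Lemma initial_total D X : initial D -> initial X -> D `<=` X \/ X `<=` D.
Proof.
move=> iD iX; have [?|/existsNP[x /not_implyP[Dx nXx]]] := pselect (D `<=` X).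
  by left.
right=> y Xy; apply: (iD x) => //; rewrite leNgt; apply/negP => xy.
by apply: nXx; apply: (iX y) => //; exact: ltW.
Qed.

Lemma len_union_approx (F : nat -> set R) A e : fborel A ->
  (forall n, measurable (F n)) -> {homo F : n k / (n <= k)%N >-> n `<=` k} ->
  \bigcup_n F n = A -> 0 < e -> exists n, len A - e < len (F n).
Proof.
move=> fA mF ndF UF e0.
have cF : mu (F n) @[n --> \oo] --> (len A)%:E.
  rewrite -lenE// -UF; apply: nondecreasing_cvg_mu => //.
    by rewrite UF; exact: fA.1.
  by move=> n k nk; apply/subsetPset; exact: ndF.
have : len A - e < len A by rewrite ltrBlDr ltrDl.
by move=> /(cvgr_gt _ (fine_cvg cF)) [N _ /(_ N (leqnn N))] /=; exists N.
Qed.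

Lemma len_tail A e : fborel A -> 0 < e ->
  exists2 n : R, 0 <= n & len (A `\` `[- n, n]) < e.
Proof.
move=> fA e0; pose F (n : nat) : set R := A `&` `[- n%:R, n%:R].
have [|||n] := @len_union_approx F A e fA _ _ _ e0.
- by move=> n; apply: measurableI; [exact: fA.1|exact: measurable_itv].
- move=> n k nk; apply: setIS => x /=.
  rewrite !in_itv/= -!ler_norml => /le_trans; apply.
  by rewrite ler_nat.
- rewrite /F -setI_bigcupr setIidl// => x _.
  exists (Num.truncn `|x|).+1 => //=; rewrite in_itv/= -ler_norml.
  by rewrite ltW// truncnS_gt.
have := lenID fA (measurable_itv `[- n%:R, n%:R]) => -> h.
by exists n%:R => //; move: h; rewrite /F; lra.
Qed.

Lemma len_below_lipschitz A x y : fborel A -> x <= y ->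
  len (A `&` `]-oo, x]) <= len (A `&` `]-oo, y]) <=
  len (A `&` `]-oo, x]) + (y - x).
Proof.
move=> fA xy.
have mx z : measurable (`]-oo, z] : set R) by exact: measurable_itv.
apply/andP; split.
  apply: le_len; [exact: (fborelIl fA (mx x)).1|exact: fborelIl|].
  by apply: setIS => z /=; rewrite !in_itv/= => /le_trans; apply.
rewrite -(len_itv false false xy); apply: len_cover.
- exact: (fborelIl fA (mx y)).1.
- exact: fborelIl.
- exact: fborel_itv.
move=> z [Az]; rewrite /= !in_itv/= => zy.
by have [zx|xz] := leP z x; [left; split; rewrite //= in_itv|right].
Qed.

Lemma continuous_len_below A : fborel A ->
  continuous (fun x => len (A `&` `]-oo, x])).
Proof.
move=> fA x; apply/cvgrPdist_lt => e e0; near=> y.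
have : `|x - y| < e by near: y; exact: cvgr_dist_lt.
apply: le_lt_trans; have [xy|/ltW yx] := leP x y.
  have /andP[h1 h2] := len_below_lipschitz fA xy.
  by rewrite distrC (distrC x) !ger0_norm ?subr_ge0//; lra.
have /andP[h1 h2] := len_below_lipschitz fA yx.
by rewrite !ger0_norm ?subr_ge0//; lra.
Unshelve. all: by end_near. Qed.

Lemma initial_below (x : R) : initial `]-oo, x].
Proof. by move=> a b ba; rewrite /= !in_itv/=; exact: le_trans. Qed.

Lemma cut_point A s : fborel A -> 0 < s < len A ->
  exists x, len (A `&` `]-oo, x]) = s.
Proof.
move=> fA /andP[s0 sA].
have [|n n0 nA] := @len_tail A (Num.min s (len A - s)) fA.
  by rewrite lt_min s0 subr_gt0.
move: nA; rewrite lt_min => /andP[ns nAs].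
have mbelow z : measurable (`]-oo, z] : set R) by exact: measurable_itv.
have lo : len (A `&` `]-oo, - n - 1]) <= s.
  apply: le_trans (ltW ns); apply: le_len.
  - exact: (fborelIl fA (mbelow _)).1.
  - by apply: fborelD => //; exact: measurable_itv.
  - by move=> x [Ax /=]; rewrite !in_itv/= => h; split => //=; rewrite ?in_itv/= => /andP[]; lra.
have hi : s <= len (A `&` `]-oo, n]).
  have : len (A `\` `]-oo, n]) <= len (A `\` `[- n, n]).
    apply: le_len.
    - exact: (fborelD fA (mbelow _)).1.
    - by apply: fborelD => //; exact: measurable_itv.
    - by move=> x [Ax /=]; rewrite !in_itv/= => h; split => //=; rewrite ?in_itv/= => /andP[]; move/negP: h; lra.
  by have := lenID fA (mbelow n); lra.
have [|||x _ xs] := @IVT _ (fun x => len (A `&` `]-oo, x])) (- n - 1) n s.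
- by lra.
- exact/continuous_subspaceT/continuous_len_below.
- by rewrite ge_min le_max lo hi orbT.
- by exists x.
Qed.

Lemma initial_cut A s : fborel A -> 0 <= s <= len A ->
  exists2 D, initial D & len (A `&` D) = s.
Proof.
move=> fA; rewrite le_eqVlt => /andP[/predU1P[<- _|s0]].
  by exists set0; rewrite ?setI0 ?len0.
rewrite le_eqVlt => /predU1P[->|sA].
  by exists setT; rewrite ?setIT.
have [|x xs] := @cut_point A s fA; first by rewrite s0.
by exists `]-oo, x]%classic => //; exact: initial_below.
Qed.

End Length.

(** * The trilinear form *)

Section TrilinearForm.
Context {R : realType}.
Implicit Types A B C D X Y : set R.
Local Notation mu := (@lebesgue_measure R).

Definition tri_set A B C : set (R * R) :=
  [set w | [/\ A w.1, B (w.2 - w.1) & C w.2]].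

(** The form [<1_A * 1_B, 1_C>], as the area of a subset of the plane whose
    second coordinate is the sum [z = x + y]; with these coordinates the
    vertical and horizontal sections give the two iterated integrals that are
    needed, and exchanging them is a symmetry of the form. *)
Definition tri A B C : R := fine ((mu \x mu)%E (tri_set A B C)).

Lemma measurable_tri_set A B C : measurable A -> measurable B -> measurable C ->
  measurable (tri_set A B C).
Proof.
move=> mA mB mC.
have mpre (f : R * R -> R) X :
    measurable_fun setT f -> measurable X -> measurable (f @^-1` X).
  by move=> mf mX; rewrite -[X in measurable X]setTI; exact: mf.
rewrite (_ : tri_set _ _ _ =
    fst @^-1` A `&` (fun w : R * R => w.2 - w.1) @^-1` B `&` snd @^-1` C).
  apply: measurableI; first apply: measurableI; apply: mpre => //.
    exact: measurable_funB.
by apply/seteqP; split=> -[x z] /= [] // [].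
Qed.

Let section_sub A B : measurable A -> measurable B ->
  forall z, measurable (A `&` [set x | B (z - x)]).
Proof.
by move=> mA mB z; apply: measurableI => //; exact: measurable_reflect.
Qed.

Lemma tri_set_xsection A B C : measurable A -> measurable B -> measurable C ->
  (mu \x mu)%E (tri_set A B C) =
  (\int[mu]_(x in A) mu ([set z | B (z - x)%R] `&` C))%E.
Proof.
move=> mA mB mC; rewrite /product_measure1 [RHS]integral_mkcond.
apply: eq_integral => x _; rewrite patchE /=.
case: ifPn => [|/negP]; rewrite inE.
  move=> Ax; congr (mu _); apply/seteqP; split=> z; rewrite /xsection/= inE/=.
    by case.
  by case.
move=> nAx; rewrite (_ : xsection _ _ = set0) ?measure0//.
by apply/seteqP; split=> z //; rewrite /xsection/= inE/= => -[].
Qed.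

Lemma tri_set_ysection A B C : measurable A -> measurable B -> measurable C ->
  (mu \x mu)%E (tri_set A B C) =
  (\int[mu]_(z in C) mu (A `&` [set x | B (z - x)%R]))%E.
Proof.
move=> mA mB mC.
rewrite (@product_measure_unique _ _ _ _ _ mu mu
  (product_measure2 mu mu)); last 2 first.
- by move=> X Y mX mY; exact: product_measure2E.
- exact: measurable_tri_set.
rewrite /= /product_measure2 [RHS]integral_mkcond.
apply: eq_integral => z _; rewrite patchE /=.
case: ifPn => [|/negP]; rewrite inE.
  move=> Cz; congr (mu _); apply/seteqP; split=> x; rewrite /ysection/= inE/=.
    by case.
  by case.
move=> nCz; rewrite (_ : ysection _ _ = set0) ?measure0//.
by apply/seteqP; split=> x //; rewrite /ysection/= inE/= => -[].
Qed.

Lemma measurable_fun_xlen A B C : measurable A -> measurable B -> measurable C ->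
  measurable_fun A (fun x => mu ([set z | B (z - x)] `&` C)).
Proof.
move=> mA mB mC.
have := @measurable_fun_xsection _ _ _ _ _ mu _
  (measurable_tri_set (@measurableT _ R) mB mC).
rewrite /= => h; apply: measurable_funTS; apply: eq_measurable_fun h => x _ /=.
by congr (mu _); apply/seteqP; split=> z; rewrite /xsection/= inE/=; case.
Qed.

Lemma measurable_fun_ylen A B C : measurable A -> measurable B -> measurable C ->
  measurable_fun C (fun z => mu (A `&` [set x | B (z - x)])).
Proof.
move=> mA mB mC.
have := @measurable_fun_ysection _ _ _ _ _ mu _
  (measurable_tri_set mA mB (@measurableT _ R)).
rewrite /= => h; apply: measurable_funTS; apply: eq_measurable_fun h => x _ /=.
by congr (mu _); apply/seteqP; split=> z; rewrite /ysection/= inE/=; case.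
Qed.

Lemma tri_setT_area A B : fborel A -> fborel B ->
  (mu \x mu)%E (tri_set A B setT) = (len A * len B)%:E.
Proof.
move=> fA fB; rewrite tri_set_xsection//; [|exact: fA.1|exact: fB.1].
under eq_integral => x _.
  rewrite setIT (lebesgue_shift (- x) fB.1) lenE//.
over.
by rewrite integral_cst//= ?lenE// -?EFinM 1?mulrC//; exact: fA.1.
Qed.

Lemma tri_set_fin A B C : fborel A -> fborel B -> measurable C ->
  (mu \x mu)%E (tri_set A B C) = (tri A B C)%:E.
Proof.
move=> fA fB mC; rewrite /tri fineK// ge0_fin_numE//.
apply: (@le_lt_trans _ _ ((mu \x mu)%E (tri_set A B setT))).
  apply: le_measure; rewrite ?inE.
  - by apply: measurable_tri_set => //; [exact: fA.1|exact: fB.1].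
  - by apply: measurable_tri_set => //; [exact: fA.1|exact: fB.1].
  - by move=> w [].
by rewrite tri_setT_area// ltry.
Qed.

Lemma tri_mono A B C A' B' C' : fborel A -> fborel B -> measurable C ->
  fborel A' -> fborel B' -> measurable C' ->
  tri_set A B C `<=` tri_set A' B' C' -> tri A B C <= tri A' B' C'.
Proof.
move=> fA fB mC fA' fB' mC' sub; rewrite -lee_fin -!tri_set_fin//.
apply: le_measure => //; rewrite inE.
  exact: (measurable_tri_set fA.1 fB.1).
exact: (measurable_tri_set fA'.1 fB'.1).
Qed.

Lemma triC A B C : measurable A -> measurable B -> measurable C ->
  tri A B C = tri B A C.
Proof.
move=> mA mB mC; rewrite /tri !tri_set_ysection//; congr fine.
apply: eq_integral => z _.
rewrite -[RHS](lebesgue_shift z); last exact: section_sub.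
rewrite -[RHS]lebesgue_opp; last first.
  by apply: (measurable_shift z); exact: section_sub.
congr (mu _); apply/seteqP; split=> x /=.
  by rewrite (addrC (- x)) subKr => -[].
by rewrite (addrC (- x)) subKr => -[].
Qed.

Lemma tri_rot A B C : measurable A -> measurable B -> measurable C ->
  tri A B C = tri C [set y | B (- y)] A.
Proof.
move=> mA mB mC; rewrite /tri tri_set_ysection// tri_set_xsection//.
  congr fine; apply: eq_integral => z _; congr (mu _).
  by apply/seteqP; split=> x /= [? ?]; split=> //; [rewrite opprB|rewrite -opprB].
exact: measurable_opp.
Qed.

Lemma tri_setT A B : fborel A -> fborel B -> tri A B setT = len A * len B.
Proof. by move=> fA fB; rewrite /tri tri_setT_area. Qed.

Lemma tri_splitC A B C X : fborel A -> fborel B -> measurable C ->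
  measurable X -> tri A B C = tri A B (C `&` X) + tri A B (C `\` X).
Proof.
move=> fA fB mC mX; apply: EFin_inj.
have mCX : measurable (C `&` X) by exact: measurableI.
have mCDX : measurable (C `\` X) by exact: measurableD.
rewrite EFinD -!tri_set_fin//.
rewrite -measureU//=; last 3 first.
- by apply: measurable_tri_set => //; [exact: fA.1|exact: fB.1].
- by apply: measurable_tri_set => //; [exact: fA.1|exact: fB.1].
- by apply/seteqP; split=> // w [[_ _ [_ Xw]] [_ _ [_]]].
congr (_ _); apply/seteqP; split=> [w [Aw Bw Cw]|w [[Aw Bw [Cw _]]|[Aw Bw [Cw _]]]].
- by have [Xw|nXw] := pselect (X w.2); [left|right]; split.
- by split.
- by split.
Qed.

(** What misses [C]; near equality makes it small, and unlike the form itself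
    it is inherited by subsets of [A] and [B]. *)
Lemma tri_setC A B C : fborel A -> fborel B -> measurable C ->
  tri A B (~` C) = len A * len B - tri A B C.
Proof.
move=> fA fB mC; rewrite -(tri_setT fA fB) (@tri_splitC A B setT C)//.
by rewrite setTI setTD addrAC subrr add0r.
Qed.

Lemma tri_le_section A B A' B' C s : fborel A -> fborel B -> fborel A' ->
  fborel B' -> fborel C -> 0 <= s ->
  (forall z, C z -> len (A `&` [set x | B (z - x)]) <=
                    len (A' `&` [set x | B' (z - x)]) + s) ->
  tri A B C <= tri A' B' C + s * len C.
Proof.
move=> fA fB fA' fB' fC s0 h.
have mC := fC.1; have mA := fA.1; have mB := fB.1.
have mA' := fA'.1; have mB' := fB'.1.
rewrite -lee_fin EFinD EFinM -!tri_set_fin// -lenE// !tri_set_ysection//.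
rewrite -integral_cst// -ge0_integralD//; last first.
  exact: measurable_fun_ylen.
apply: ge0_le_integral => //.
- exact: measurable_fun_ylen.
- by apply: emeasurable_funD; [exact: measurable_fun_ylen|exact: measurable_cst].
- move=> z Cz; rewrite /= !lenE ?lee_fin ?h//; apply: fborelIl => //;
  exact: measurable_reflect.
Qed.

Lemma tri_ge_section A B A' B' C s : fborel A -> fborel B -> fborel A' ->
  fborel B' -> fborel C -> 0 <= s ->
  (forall z, C z -> len (A' `&` [set x | B' (z - x)]) + s <=
                    len (A `&` [set x | B (z - x)])) ->
  tri A' B' C + s * len C <= tri A B C.
Proof.
move=> fA fB fA' fB' fC s0 h.
have mC := fC.1; have mA := fA.1; have mB := fB.1.
have mA' := fA'.1; have mB' := fB'.1.
rewrite -lee_fin EFinD EFinM -!tri_set_fin// -lenE// !tri_set_ysection//.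
rewrite -integral_cst// -ge0_integralD//; last first.
  exact: measurable_fun_ylen.
apply: ge0_le_integral => //.
- by move=> z Cz; rewrite adde_ge0 ?lee_fin.
- by apply: emeasurable_funD; [exact: measurable_fun_ylen|exact: measurable_cst].
- exact: measurable_fun_ylen.
- move=> z Cz; rewrite /= !lenE ?lee_fin ?h//; apply: fborelIl => //;
  exact: measurable_reflect.
Qed.

Lemma tri_le_cst A B C c : fborel A -> fborel B -> measurable C ->
  (forall x, A x -> len ([set z | B (z - x)] `&` C) <= c) ->
  tri A B C <= c * len A.
Proof.
move=> fA fB mC h; have mA := fA.1; have mB := fB.1.
rewrite -lee_fin -tri_set_fin// tri_set_xsection// EFinM -(lenE fA).
rewrite -integral_cst//; apply: ge0_le_integral => //.
  exact: measurable_fun_xlen.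
move=> x Ax /=; rewrite lenE ?lee_fin ?h//.
by apply: fborelIl => //; exact: (fborel_shift (- x)).
Qed.

Lemma tri_ge_cst A B C c : fborel A -> fborel B -> measurable C -> 0 <= c ->
  (forall x, A x -> c <= len ([set z | B (z - x)] `&` C)) ->
  c * len A <= tri A B C.
Proof.
move=> fA fB mC c0 h; have mA := fA.1; have mB := fB.1.
rewrite -lee_fin -tri_set_fin// tri_set_xsection// EFinM -(lenE fA).
rewrite -integral_cst//; apply: ge0_le_integral => //.
  exact: measurable_fun_xlen.
move=> x Ax /=; rewrite lenE ?lee_fin ?h//.
by apply: fborelIl => //; exact: (fborel_shift (- x)).
Qed.

Lemma tri_le_mulAC A B C : fborel A -> fborel B -> fborel C ->
  tri A B C <= len A * len C.
Proof.
move=> fA fB fC; rewrite mulrC; apply: (tri_le_cst fA fB fC.1) => x Ax; apply: (le_len _ fC) => [|z []//].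
by apply: measurableI; [exact: (measurable_shift (- x) fB.1)|exact: fC.1].
Qed.

(** Markov's inequality for the vertical sections. *)
Lemma tri_markov A B C d : fborel A -> fborel B -> measurable C -> 0 <= d ->
  exists X, [/\ measurable X, X `<=` A,
    forall x, X x -> len ([set z | B (z - x)] `&` C) <= d &
    len (A `\` X) * d <= tri A B C].
Proof.
move=> fA fB mC d0; have mA := fA.1; have mB := fB.1.
have mf := measurable_fun_xlen mA mB mC.
pose f x := mu ([set z | B (z - x)] `&` C).
pose X := A `&` f @^-1` [set y | (y <= d%:E)%E].
have mX : measurable X.
  by apply: mf => //; rewrite -set_itvNyc; exact: emeasurable_itv.
exists X; split=> //; first by move=> x [].
  move=> x [Ax]; rewrite /f /= lenE ?lee_fin//.
  by apply: fborelIl => //; exact: (fborel_shift (- x)).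
have mAX : measurable (A `\` X) by exact: measurableD.
rewrite -lee_fin mulrC EFinM -lenE; last exact: fborelD.
rewrite -integral_cst// -tri_set_fin// tri_set_xsection//.
apply: (@le_trans _ _ (\int[mu]_(x in A `\` X) f x)%E).
  apply: ge0_le_integral => //.
    by apply: measurable_funS mf => // x [].
  move=> x [Ax nXx] /=; rewrite leNgt; apply/negP => /ltW h.
  by apply: nXx; split.
by apply: ge0_subset_integral => // x [].
Qed.

End TrilinearForm.

(** * Sets on a circle almost closed under addition *)

Section Circle.
Context {R : realType}.
Implicit Types A B C D S U V X Y : set R.

(** An open set containing [S] with small excess contains the translates of most
    of its points by short vectors. *)
Lemma len_shift_continuous S e : fborel S -> 0 < e ->
  exists2 r, 0 < r & forall x, `|x| < r -> len (S `\` [set y | S (y + x)]) <= e.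
Proof.
move=> fS e0; have e20 : 0 < e / 2 by rewrite divr_gt0.
have [U [oU SU US]] := lebesgue_regularity_outer fS.1 fS.2 e20.
have mU : measurable U by exact: open_measurable.
have fUS : fborel (U `\` S).
  split; first exact: (measurableD mU fS.1).
  by rewrite (lt_trans US)// ltry.
have fU : fborel U.
  rewrite (_ : U = U `\` S `|` S); first exact: fborelU.
  by rewrite setUC setDUK.
pose F n : set R := ~` \bigcup_(y in ~` U) ball y (n.+1%:R^-1).
have oF n : open (\bigcup_(y in ~` U) ball y (n.+1%:R^-1 : R)).
  by apply: bigcup_open => y _; exact: ball_open.
have mF n : measurable (F n) by apply: measurableC; exact: open_measurable.
have FU n : F n `<=` U.
  move=> x Fx; apply: contrapT => nUx; apply: Fx; exists x => //.
  exact: ballxx.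
have [||n] := @len_union_approx _ F U _ fU mF _ _ e20.
- move=> n k nk; apply: subsetC => x [y nUy yx]; exists y => //.
  apply: le_ball yx; rewrite lef_pV2 ?posrE ?ltr0n// ler_nat ltnS.
  exact: nk.
- apply/seteqP; split=> [x [n _]|x Ux]; first exact: FU.
  have /nbhs_ballP[r /= r0 xr] := open_nbhs_nbhs (conj oU Ux).
  have [n _ /(_ n (leqnn n)) nr] := near_infty_natSinv_lt (PosNum r0).
  exists n => // -[y nUy yx]; apply: nUy; apply: xr.
  by apply: le_ball (ball_sym yx); exact: ltW.
move=> h; exists n.+1%:R^-1; first by rewrite invr_gt0 ltr0n.
move=> x xn; have eE : e = e / 2 + e / 2 by rewrite -splitr.
have lUF : len (U `\` F n) <= e / 2.
  have := lenID fU (mF n).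
  rewrite (_ : U `&` F n = F n) ?setIidr//; lra.
have fsh : fborel [set y | (U `\` S) (y + x)] by exact: fborel_shift.
have lUS : len [set y | (U `\` S) (y + x)] <= e / 2.
  by rewrite (len_shift x fUS.1) -lee_fin -lenE// ltW.
have := @len_cover _ (S `\` [set y | S (y + x)]) (U `\` F n)
   [set y | (U `\` S) (y + x)] _ _ fsh.
suff H : len (U `\` F n) + len [set y | (U `\` S) (y + x)] <= e.
  move=> K; apply: le_trans H; apply: K.
  - by apply: measurableD; [exact: fS.1|exact: measurable_shift fS.1].
  - exact: fborelD.
  move=> y [Sy nSyx]; have [Fy|] := pselect (F n y); last first.
    by left; split => //; exact: SU.
  right; split => //; apply: contrapT => nU; apply: Fy; exists (y + x) => //.
  by rewrite /ball/= addrC addKr.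
by rewrite eE; exact: lerD.
Qed.

Definition periodic (p : R) U : Prop := forall z, U (z + p) <-> U z.

Lemma periodic_int p U (k : int) z : periodic p U -> U (z + p *~ k) <-> U z.
Proof.
move=> pU; elim: k z => [z|n IH z|n IH z]; first by rewrite mulr0z addr0.
  by rewrite -addn1 PoszD mulrzDr mulr1z addrA pU IH.
rewrite -addn1 PoszD opprD mulrzDr mulrN1z addrA.
by rewrite -(IH z) -(pU (_ - p)) subrK.
Qed.

Lemma periodic_shift p U x : periodic p U -> periodic p [set z | U (z + x)].
Proof. by move=> pU z /=; rewrite addrAC; exact: pU. Qed.

Lemma periodic_setI p U V : periodic p U -> periodic p V -> periodic p (U `&` V).
Proof. by move=> pU pV z; split=> -[/pU ? /pV ?]. Qed.

Lemma periodic_setD p U V : periodic p U -> periodic p V -> periodic p (U `\` V).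
Proof.
by move=> pU pV z; split=> -[/pU ? nV]; split=> // /pV.
Qed.

(** A period of a periodic set has the same length wherever it starts: this is
    the rotation invariance of length on the circle of circumference [p]. *)
Lemma period_len_shift p U x : 0 < p -> measurable U -> periodic p U ->
  len ([set z | U (z + x)] `&` `[0, p[) = len (U `&` `[0, p[).
Proof.
move=> p0 mU pU.
wlog x0p : x / 0 <= x < p => [hwlog|].
  pose r := x - p *~ Num.floor (x / p).
  have -> : [set z | U (z + x)] = [set z | U (z + r)].
    apply/seteqP; split=> z /=; rewrite /r => h.
      by rewrite addrA -mulrNz periodic_int.
    by rewrite -(periodic_int (- Num.floor (x / p)) _ pU) -addrA mulrNz.
  apply: hwlog; have /andP[h1 h2] := floor_itv (x / p).
  rewrite /r -[p *~ _]mulrzl subr_ge0 ltrBlDr.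
  rewrite -ler_pdivlMr// h1/=.
  move: h2; rewrite intrD ltr_pdivrMr// => /lt_le_trans; apply.
  by rewrite mulrDl mul1r addrC.
have /andP[x0 xp] := x0p.
have mi a b : measurable (`[a, b[%classic : set R) by exact: measurable_itv.
have fi a b : fborel (`[a, b[%classic : set R) by exact: fborel_itv.
have fUi a b : fborel (U `&` `[a, b[) by exact: fborelIr.
have split3 a b c : a <= b -> b <= c ->
    len (U `&` `[a, c[) = len (U `&` `[a, b[) + len (U `&` `[b, c[).
  move=> ab bc; rewrite -lenU//.
    congr len; rewrite -setIUr; congr (_ `&` _).
    apply/seteqP; split=> z /=; rewrite !in_itv/=.
      by have [zb|bz] := ltP z b => /andP[h1 h2]; [left|right]; rewrite ?h1// ?h2 ?zb.
    by case=> /andP[h1 h2]; apply/andP; split; lra.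
  move=> z [[_] + [_]]; rewrite /= !in_itv/= => /andP[_ h1] /andP[h2 _].
  by move: h1; rewrite ltNge h2.
transitivity (len (U `&` `[x, p + x[)).
  rewrite -[RHS](len_shift x); last exact: (fUi _ _).1.
  congr len; apply/seteqP; split=> z /=; rewrite !in_itv/=;
    move=> [? /andP[? ?]]; split=> //; apply/andP; split; lra.
rewrite (split3 x p (p + x)); [|exact: ltW|by rewrite lerDl].
rewrite (split3 0 x p)// ?ltW// addrC; congr (_ + _).
rewrite -(len_shift p); last exact: (fUi _ _).1.
congr len; apply/seteqP; split=> z /=; rewrite !in_itv/= => -[h /andP[? ?]].
  by split; [exact/(pU z)|apply/andP; split; lra].
by split; [exact/(pU z)|apply/andP; split; lra].
Qed.

Section Rotation.
Variables (p : R) (U V : set R) (d k : R).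
Hypotheses (p0 : 0 < p) (mU : measurable U) (mV : measurable V).
Hypotheses (pU : periodic p U) (pV : periodic p V).
Let per X := len (X `&` `[0, p[).
Let loss x := per (U `\` [set z | U (z + x)]).
Hypotheses (UV : per (U `\` V) <= d) (lossV : forall x, V x -> loss x <= k).
Hypotheses (d0 : 0 <= d) (k0 : 0 <= k) (dkU : 2 * d + 4 * k < per U).

Let mUx x : measurable [set z | U (z + x)]. Proof. exact: measurable_shift. Qed.

Let fi X : measurable X -> fborel (X `&` `[0, p[).
Proof. by move=> mX; apply: fborelIr => //; exact: fborel_itv. Qed.

Let per_cover X Y Z : measurable X -> measurable Y -> measurable Z ->
  X `<=` Y `|` Z -> per X <= per Y + per Z.
Proof.
move=> mX mY mZ XYZ; apply: len_cover; [exact: (fi mX).1|exact: fi|exact: fi|].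
by move=> z [/XYZ[]]; [left|right].
Qed.

Let lossD x y : loss (x + y) <= loss x + loss y.
Proof.
rewrite /loss -[X in _ <= _ + X](@period_len_shift p (U `\` [set z | U (z + y)]) x)//; last first.
- by apply: periodic_setD => //; exact: periodic_shift.
- exact: measurableD.
apply: per_cover; [exact: measurableD|exact: measurableD| |].
  by apply: (measurable_shift x); exact: measurableD.
move=> z [Uz nU]; have [Uzx|] := pselect (U (z + x)); last by left.
by right; split=> //=; rewrite -addrA.
Qed.

Let overlapE x : per (U `&` [set z | U (z + x)]) = per U - loss x.
Proof.
rewrite /loss /per (lenID (fi mU) (mUx x)) setIAC.
suff -> : (U `\` [set z | U (z + x)]) `&` `[0, p[ =
  (U `&` `[0, p[) `\` [set z | U (z + x)] by rewrite addrK.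
by rewrite !setDE setIAC.
Qed.

Let lossN x : loss (- x) = loss x.
Proof.
have E : per (U `&` [set z | U (z - x)]) = per (U `&` [set z | U (z + x)]).
  rewrite /per -(@period_len_shift p (U `&` [set z | U (z - x)]) x)//.
  - by congr (len (_ `&` _)); apply/seteqP; split=> z /= [];
      rewrite ?addrK; split=> //; rewrite ?addrK.
  - by apply: measurableI => //; exact: mUx.
  - by apply: periodic_setI => //; exact: (@periodic_shift _ _ (- x)).
have := overlapE x; have := overlapE (- x); rewrite E; lra.
Qed.

(** The key dichotomy: a rotation that moves more than [2 * d] of the set
    into itself carries a point of [V] to a point of [V], hence is a
    difference of two elements of [V] and loses at most [2 * k]. *)
Let gap x : loss x < per U - 2 * d -> loss x <= 2 * k.
Proof.
move=> lx; have ov : 2 * d < per (U `&` [set z | U (z + x)]).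
  by rewrite overlapE; lra.
have [y [[Vy Vyx] _]] : exists y, (V `&` [set z | V (z + x)] `&` `[0, p[) y.
  apply: len_gt0_nonempty.
  have mUV : measurable (U `\` V) by exact: measurableD.
  have mVx : measurable [set z | V (z + x)] by exact: measurable_shift.
  have h1 : per (U `&` [set z | U (z + x)]) <=
      per (V `&` [set z | V (z + x)]) +
      per ((U `\` V) `|` [set z | (U `\` V) (z + x)]).
    apply: per_cover.
    - exact: measurableI.
    - exact: measurableI.
    - by apply: measurableU => //; exact: measurable_shift.
    move=> z [Uz Uzx].
    have [Vz|] := pselect (V z); last by right; left.
    by have [Vzx|] := pselect (V (z + x)); [left|right; right].
  have h2 : per ((U `\` V) `|` [set z | (U `\` V) (z + x)]) <= d + d.
    apply: (@le_trans _ _ (per (U `\` V) + per [set z | (U `\` V) (z + x)])).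
      apply: per_cover => //; last exact: measurable_shift.
      by apply: measurableU => //; exact: measurable_shift.
    rewrite {2}/per period_len_shift//; first exact: lerD.
    exact: periodic_setD.
  by rewrite /per in h1 h2 ov *; lra.
have -> : x = - y + (y + x) by rewrite addKr.
apply: le_trans (lossD _ _) _; rewrite lossN mulr_natl mulr2n.
by apply: lerD; exact: lossV.
Qed.

Let small_loss : exists2 r, 0 < r & forall x, `|x| < r -> loss x <= 2 * k.
Proof.
have : 0 < per U - 2 * d by move: dkU k0; lra.
set w := per U - 2 * d => w0; have e0 : 0 < w / 4 by rewrite divr_gt0.
have [r r0 hr] := len_shift_continuous (fi mU) e0.
exists r => // x /hr h; apply: gap; rewrite -/w.
suff : loss x <= w / 4 by move: w0; lra.
apply: le_trans h; apply: le_len.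
- by apply: (fi _).1; exact: measurableD.
- by apply: fborelD; [exact: fi|apply: measurable_shift; exact: (fi mU).1].
by move=> z [[Uz nUz] zp]; split=> // -[].
Qed.

(** Steps too short to leave the small side of the dichotomy reach every [x]. *)
Let loss_le x : loss x <= 2 * k.
Proof.
have [r r0 hr] := small_loss.
pose n := (Num.truncn (`|x| / r)).+1.
have n0 : 0 < n%:R :> R by rewrite ltr0n.
have xn : `|x / n%:R| < r.
  rewrite normrM normfV (ger0_norm (ltW n0)) ltr_pdivrMr// mulrC -ltr_pdivrMr//.
  exact: truncnS_gt.
suff : forall i : nat, loss (x / n%:R *+ i) <= 2 * k.
  by move=> /(_ n); rewrite -mulr_natr divfK// gt_eqF.
elim=> [|i IH]; first by rewrite mulr0n; apply: hr; rewrite normr0.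
apply: gap; rewrite mulrS.
move: dkU IH (lossD (x / n%:R) (x / n%:R *+ i)) (hr _ xn); lra.
Qed.

(** The mean overlap of the set with its rotations is the square of its length
    divided by [p], while no rotation loses more than [2 * k]. *)
Lemma almost_closed_fills_circle : p * (per U - 2 * k) <= per U ^+ 2.
Proof.
have fU := fi mU; have fp : fborel (`[0, p[%classic : set R) by exact: fborel_itv.
have E : tri (U `&` `[0, p[) `[0, p[ U = tri `[0, p[ (U `&` `[0, p[) U.
  exact: (triC fU.1 fp.1 mU).
have lp : len (`[0, p[%classic : set R) = p by rewrite len_itv ?subr0// ltW.
have le1 : (per U - 2 * k) * len (`[0, p[%classic : set R) <=
    tri `[0, p[ (U `&` `[0, p[) U.
  apply: (tri_ge_cst fp fU mU) => [|x _]; first by move: dkU d0 k0; lra.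
  have -> : len ([set z | (U `&` `[0, p[) (z - x)] `&` U) =
            per (U `&` [set z | U (z + x)]).
    rewrite -(len_shift x); last first.
      by apply: measurableI => //; exact: (measurable_shift (- x) fU.1).
    by congr len; apply/seteqP; split=> z /=; rewrite addrK; tauto.
  by rewrite overlapE; move: (loss_le x); lra.
move: le1; rewrite lp mulrC => /le_trans; apply.
rewrite -E expr2; apply: (tri_le_cst fU fp mU) => x _.
rewrite -(len_shift x); last first.
  by apply: measurableI => //; exact: (measurable_shift (- x) fp.1).
rewrite /per -(@period_len_shift p U x)//.
apply: le_len; [| |by move=> z /=; rewrite addrK; tauto].
  apply: (measurable_shift x); apply: measurableI => //.
  exact: (measurable_shift (- x) fp.1).
exact: fi.
Qed.

End Rotation.

End Circle.

(** * Two sets with a small sumset, in normalized position *)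

Section Core.
Context {R : realType}.
Implicit Types A B C D E F G H S U V X Y : set R.

Definition periodize (p : R) S : set R :=
  \bigcup_n ([set z | S (z + p *~ n%:Z)] `|` [set z | S (z - p *~ n%:Z)]).

Lemma periodizeP p S z : periodize p S z <-> exists k : int, S (z + p *~ k).
Proof.
split=> [[n _ []/= Sz]|[[n|n] Sz]].
- by exists n.
- by exists (- n%:Z); rewrite mulrNz.
- by exists n => //; left.
- by exists n.+1 => //; right; rewrite /= -mulrNz.
Qed.

Lemma measurable_periodize p S : measurable S -> measurable (periodize p S).
Proof.
move=> mS; apply: bigcupT_measurable => n.
by apply: measurableU; exact: measurable_shift.
Qed.

Lemma periodic_periodize p S : periodic p (periodize p S).
Proof.
move=> z; rewrite !periodizeP; split=> -[k Sz].
  by exists (k + 1); rewrite mulrzDr mulr1z [_ *~ k + _]addrC addrA.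
by exists (k - 1); rewrite mulrzBr mulr1z [_ *~ k - _]addrC addrA addrK.
Qed.

Lemma periodize_period p S : 0 < p -> S `<=` `[0, p[ ->
  periodize p S `&` `[0, p[ = S.
Proof.
move=> p0 Sp; apply/seteqP; split=> [z [/periodizeP[k Sz] zp]|z Sz]; last first.
  by split; [apply/periodizeP; exists 0; rewrite mulr0z addr0|exact: Sp].
have := Sp _ Sz; move: zp; rewrite /= !in_itv/= => /andP[z0 zp] /andP[zk0 zkp].
suff k0 : k = 0 by move: Sz; rewrite k0 mulr0z addr0.
rewrite -mulrzl in zk0 zkp.
have h1 : -1 < k%:~R :> R by nra.
have h2 : k%:~R < 1 :> R by nra.
by move: h1 h2; rewrite (ltrz1 R) -(mulrN1z 1) ltr_int; lia.
Qed.

Lemma almost_fill G X Y d c : fborel G -> fborel X -> fborel Y ->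
  X `&` Y `<=` set0 -> len G <= len X + len Y + c ->
  len (X `\` G) <= d -> len (Y `\` G) <= d ->
  len (G `\` (X `|` Y)) <= c + 2 * d.
Proof.
move=> fG fX fY XY GXY Xd Yd.
have h1 := lenID fG (measurableU _ _ fX.1 fY.1).
have h2 := lenID (fborelU fX fY) fG.1.
have h3 := lenU fX fY XY.
have h4 : len ((X `|` Y) `\` G) <= len (X `\` G) + len (Y `\` G).
  apply: len_cover; [|exact: (fborelD fX fG.1)|exact: (fborelD fY fG.1)|].
    by apply: measurableD; [exact: measurableU fX.1 fY.1|exact: fG.1].
  by move=> z [[Xz|Yz] nG]; [left|right].
rewrite setIC in h1; lra.
Qed.

(** The translates [F] and [q + E], by endpoints of the other set, are disjoint,
    almost contained in [G] and together about as long as [G], so that [G] is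
    almost [F] followed by [q + E]; likewise it is almost [E] followed by
    [p + F]. Comparing the two descriptions shows that, up to [2 * p], [F] and [G]
    continue [E] periodically with period [p]. Hence [x + E] almost lies in [E]
    modulo [p] for most [x] in [E], and such a set fills the circle. *)
Lemma full_of_endpoint_translates E F G H p q d :
  fborel E -> fborel F -> fborel G -> measurable H ->
  0 < p -> p <= q -> 0 < d ->
  E `<=` `[0, p[ -> F `<=` `[0, q[ -> H `<=` E ->
  200 * d <= len E -> len G <= len E + len F + 8 * d ->
  len (E `\` H) <= d ->
  (forall x, H x -> len ([set z | F (z - x)] `\` G) <= d) ->
  len (F `\` G) <= d -> len ([set z | F (z - p)] `\` G) <= d ->
  len (E `\` G) <= d -> len ([set z | E (z - q)] `\` G) <= d ->
  p <= len E + 132 * d /\ len (E `\` F) <= 11 * d.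
Proof.
move=> fE fF fG mH p0 pq d0 Ep Fq HE dE GEF EH HF FG pFG EG qEG.
have mE := fE.1; have mF := fF.1; have mG := fG.1.
have fqE : fborel [set z | E (z - q)] by exact: (fborel_shift (- q)).
have fpF : fborel [set z | F (z - p)] by exact: (fborel_shift (- p)).
have Ein z : E z -> 0 <= z < p by move=> /Ep; rewrite /= in_itv.
have Fin z : F z -> 0 <= z < q by move=> /Fq; rewrite /= in_itv.
pose W := F `|` [set z | E (z - q)].
pose W' := E `|` [set z | F (z - p)].
have fW : fborel W by exact: fborelU.
have fW' : fborel W' by exact: fborelU.
have GW : len (G `\` W) <= 10 * d.
  have -> : 10 * d = 8 * d + 2 * d by ring.
  apply: almost_fill => //.
    by move=> z [/Fin/andP[h1 h2] /Ein/andP[h3 h4]]; lra.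
  by rewrite (len_shift (- q))// [len F + _]addrC.
have GW' : len (G `\` W') <= 10 * d.
  have -> : 10 * d = 8 * d + 2 * d by ring.
  apply: almost_fill => //.
    by move=> z [/Ein/andP[h1 h2] /Fin/andP[h3 h4]]; lra.
  by rewrite (len_shift (- p)).
have fGW : fborel (G `\` W) by exact: fborelD fG fW.1.
have fGW' : fborel (G `\` W') by exact: fborelD fG fW'.1.
have fEG : fborel (E `\` G) by exact: fborelD.
have fFG : fborel (F `\` G) by exact: fborelD.
have EF : len (E `\` F) <= 11 * d.
  have : len (E `\` F) <= len (E `\` G) + len (G `\` W).
    apply: len_cover => //; first exact: measurableD.
    move=> z [Ez nFz]; have [Gz|] := pselect (G z); last by left.
    right; split=> // -[//|/Ein/andP[]].
    by have /andP[] := Ein _ Ez; lra.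
  lra.
split=> //.
pose F' := F `&` `[0, p[.
have fF'E : fborel (F' `\` E).
  by apply: fborelD => //; apply: fborelIl => //; exact: measurable_itv.
have F'E : len (F' `\` E) <= 11 * d.
  have : len (F' `\` E) <= len (F `\` G) + len (G `\` W').
    apply: len_cover => //; first exact: fF'E.1.
    move=> z [[Fz zp] nEz]; have [Gz|] := pselect (G z); last by left.
    right; split=> // -[//|/Fin/andP[]].
    by move: zp; rewrite /= in_itv/= => /andP[]; lra.
  lra.
pose U := periodize p E; pose V := periodize p H.
have UE : U `&` `[0, p[ = E by exact: periodize_period.
have VH : V `&` `[0, p[ = H.
  by apply: periodize_period => //; exact: subset_trans Ep.
have mU : measurable U by exact: measurable_periodize.
have mV : measurable V by exact: measurable_periodize.
have pU : periodic p U by exact: periodic_periodize.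
have EU z : E z -> U z by rewrite -{1}UE => -[].
have loss x : H x -> len (E `\` [set z | U (z + x)]) <= 33 * d.
  move=> Hx; have /andP[x0 xp] := Ein _ (HE _ Hx).
  pose Y1 := E `\` F.
  pose Y2 := [set y | ([set z | F (z - x)] `\` G) (y + x)].
  pose Y3 := [set y | (G `\` W') (y + x)].
  pose Y4 := [set y | (F' `\` E) (y + (x - p))].
  have fY1 : fborel Y1 by exact: fborelD.
  have fF_ : fborel ([set z | F (z - x)] `\` G).
    by apply: fborelD => //; exact: (fborel_shift (- x)).
  have fY2 : fborel Y2 by exact: fborel_shift.
  have fY3 : fborel Y3 by exact: fborel_shift.
  have fY4 : fborel Y4 by exact: fborel_shift.
  have l2 : len Y2 <= d by rewrite len_shift ?HF//; exact: fF_.1.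
  have l3 : len Y3 <= 10 * d by rewrite len_shift//; exact: fGW'.1.
  have l4 : len Y4 <= 11 * d by rewrite len_shift//; exact: fF'E.1.
  have l12 := lenU_le fY1 fY2; have l34 := lenU_le fY3 fY4.
  have : len (E `\` [set z | U (z + x)]) <= len (Y1 `|` Y2) + len (Y3 `|` Y4).
    apply: len_cover; [|exact: fborelU|exact: fborelU|].
      by apply: measurableD => //; exact: measurable_shift.
    move=> y [Ey nU]; have /andP[y0 yp] := Ein _ Ey.
    have [Fy|] := pselect (F y); last by left; left.
    have [Gyx|nG] := pselect (G (y + x)); last first.
      by left; right; split => //=; rewrite addrK.
    right; have [W'yx|nW'] := pselect (W' (y + x)); last by left.
    case: W'yx => [/EU//|/= Fyx]; right.
    split; first split.
    - by rewrite addrA.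
    - by have /andP[h1 h2] := Fin _ Fyx; rewrite /= in_itv/=; apply/andP; split; lra.
    rewrite addrA => /EU Uyx; apply: nU => /=.
    by rewrite -(pU (_ - p)) subrK in Uyx.
  rewrite /Y1 in l12 *; lra.
have := @almost_closed_fills_circle R p U V d (33 * d) p0 mU mV pU
  (@periodic_periodize p H).
rewrite UE => K.
have {K} : p * (len E - 2 * (33 * d)) <= len E ^+ 2.
  apply: K.
  - have -> : (U `\` V) `&` `[0, p[ = E `\` H.
      apply/seteqP; split=> z.
        move=> [[Uz nVz] zp]; split; first by rewrite -UE.
        by rewrite -VH => -[].
      move=> [Ez nHz]; have zp := Ep _ Ez; split=> //; split; first exact: EU.
      by move=> Vz; apply: nHz; rewrite -VH.
    exact: EH.
  - move=> x /periodizeP[k Hx]; apply: le_trans (loss _ Hx).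
    apply: le_len; last first.
    + move=> z [[Uz nUz] zp]; split; first by rewrite -UE.
      by move=> /=; rewrite addrA periodic_int.
    + by apply: fborelD => //; exact: measurable_shift.
    + apply: measurableI; last exact: measurable_itv.
      by apply: measurableD => //; exact: measurable_shift.
  - exact: ltW.
  - by lra.
  - by lra.
move=> K; rewrite leNgt; apply/negP => pE.
have : 0 <= (p - (len E + 132 * d)) * (len E - 66 * d) by apply: mulr_ge0; lra.
have : 0 < d * (66 * len E - 8712 * d) by apply: mulr_gt0; lra.
nra.
Qed.

End Core.

(** * Two sets with a small sumset *)

Section SmallSumset.
Context {R : realType}.
Implicit Types A B C D E F G H S U V X Y : set R.

(** [X] meets every piece of [A] longer than [d], in particular the two pieces of
    length [2 * d] at the ends of [A]. *)
Lemma near_endpoints A X d : fborel A -> measurable X -> X `<=` A -> 0 < d ->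
  4 * d < len A -> len (A `\` X) <= d ->
  exists x0 x1, [/\ X x0, X x1, x0 < x1 & len (A `\` `[x0, x1[) <= 4 * d].
Proof.
move=> fA mX XA d0 dA AX.
have [|D iD lD] := @initial_cut _ A (2 * d) fA; first by apply/andP; split; lra.
have [|D' iD' lD'] := @initial_cut _ A (len A - 2 * d) fA.
  by apply/andP; split; lra.
have mD := initial_measurable iD; have mD' := initial_measurable iD'.
have fAX : fborel (A `\` X) by exact: fborelD.
have hit S : measurable S -> d < len (A `&` S) -> exists2 x, X x & S x.
  move=> mS dS; apply: contrapT => nXS.
  have : len (A `&` S) <= len (A `\` X).
    apply: le_len => //; first exact: (fborelIl fA mS).1.
    by move=> z [Az Sz]; split => // Xz; apply: nXS; exists z.
  lra.
have AD' : len (A `\` D') = 2 * d by have := lenID fA mD'; lra.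
have [x0 Xx0 Dx0] : exists2 x, X x & D x by apply: hit => //; lra.
have [x1 Xx1 nDx1] : exists2 x, X x & (~` D') x.
  by apply: hit; [exact: measurableC|rewrite -setDE; lra].
have DD' : D `<=` D'.
  have [//|D'D] := initial_total iD iD'.
  have : len (A `&` D') <= len (A `&` D); last by lra.
  apply: le_len; [exact: (fborelIl fA mD').1|exact: fborelIl|exact: setIS].
exists x0, x1; split=> //.
  rewrite ltNge; apply/negP => x10; apply: nDx1.
  by apply: (iD' x0) => //; exact: DD'.
have : len (A `\` `[x0, x1[) <= len (A `&` D) + len (A `\` D'); last by lra.
apply: len_cover; [|exact: fborelIl|exact: fborelD|].
  by apply: measurableD; [exact: fA.1|exact: measurable_itv].
move=> z [Az nz]; have [zx0|x0z] := leP z x0.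
  by left; split => //; exact: (iD x0).
right; split=> // Dz; apply: nz; rewrite /= in_itv/= (ltW x0z)/=.
by rewrite ltNge; apply/negP => x1z; apply: nDx1; exact: (iD' z).
Qed.

(** The previous lemma for the parts of [E] and [F] between endpoints [x0], [x1]
    and [y0], [y1] whose translates almost stay within [G]. *)
Lemma full_between_endpoints E F G X d x0 x1 y0 y1 :
  fborel E -> fborel F -> fborel G -> measurable X -> X `<=` E -> 0 < d ->
  204 * d <= len E -> len G <= len E + len F -> len (E `\` X) <= d ->
  (forall x, X x -> len ([set z | F (z - x)] `\` G) <= d) ->
  X x0 -> X x1 -> x0 < x1 -> len (E `\` `[x0, x1[) <= 4 * d ->
  len ([set z | E (z - y0)] `\` G) <= d ->
  len ([set z | E (z - y1)] `\` G) <= d ->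
  len (F `\` `[y0, y1[) <= 4 * d -> x1 - x0 <= y1 - y0 ->
  x1 - x0 <= len (E `&` `[x0, x1[) + 132 * d /\
  len ((E `&` `[x0, x1[) `\` [set z | F (z + (y0 - x0))]) <= 11 * d.
Proof.
move=> fE fF fG mX XE d0 dE GEF EX XF Xx0 Xx1 x01 Ex Ey0 Ey1 Fy pq.
have mi a b : measurable (`[a, b[%classic : set R) by exact: measurable_itv.
have fE1 : fborel (E `&` `[x0, x1[) by exact: fborelIl.
have fF1 : fborel (F `&` `[y0, y1[) by exact: fborelIl.
have lE1 := lenID fE (mi x0 x1); have lF1 := lenID fF (mi y0 y1).
pose E' := [set x | (E `&` `[x0, x1[) (x + x0)].
pose F' := [set y | (F `&` `[y0, y1[) (y + y0)].
pose G' := [set z | G (z + (x0 + y0))].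
pose H' := [set x | (X `&` `[x0, x1[) (x + x0)].
have fE' : fborel E' by exact: fborel_shift.
have fF' : fborel F' by exact: fborel_shift.
have fG' : fborel G' by exact: fborel_shift.
have mH' : measurable H'.
  by apply: (measurable_shift x0); exact: measurableI.
have lE' : len E' = len (E `&` `[x0, x1[) by rewrite len_shift//; exact: fE1.1.
have lF' : len F' = len (F `&` `[y0, y1[) by rewrite len_shift//; exact: fF1.1.
have lG' : len G' = len G by rewrite len_shift//; exact: fG.1.
(* Translates of the normalized sets, read back in the original coordinates. *)
have tr A S c x y : fborel A -> measurable S -> S `<=` A ->
    (forall z, z + (x0 + y0) - y = z - x + c) ->
    len ([set z | A (z - y)] `\` G) <= d ->
    len ([set z | S (z - x + c)] `\` G') <= d.
  move=> fA mS SA zxy; apply: le_trans.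
  have fAy : fborel ([set z | A (z - y)] `\` G).
    by apply: fborelD; [exact: (fborel_shift (- y))|exact: fG.1].
  rewrite -(len_shift (x0 + y0) fAy.1).
  apply: le_len; last by move=> z [/SA Az nG]; split=> //=; rewrite zxy.
    apply: measurableD; last exact: fG'.1.
    rewrite (_ : mkset _ = [set z | S (z + (c - x))]); first exact: measurable_shift.
    by apply/seteqP; split=> z /=; rewrite (_ : z - x + c = z + (c - x))//; ring.
  exact: fborel_shift.
have [||||||||||||||] :=
  @full_of_endpoint_translates R E' F' G' H' (x1 - x0) (y1 - y0) d fE' fF' fG' mH'.
- by rewrite subr_gt0.
- by [].
- by [].
- by move=> z [_]; rewrite /= !in_itv/= => /andP[? ?]; apply/andP; split; lra.
- by move=> z [_]; rewrite /= !in_itv/= => /andP[? ?]; apply/andP; split; lra.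
- by move=> z [/XE ? ?]; split.
- by rewrite lE'; lra.
- by rewrite lE' lF' lG'; lra.
- apply: le_trans EX; rewrite -(len_shift x0 (fborelD fE mX).1).
  apply: le_len; [exact: measurableD fE'.1 mH'| |].
    by apply: fborel_shift; exact: fborelD.
  by move=> z [[Ez zi] nH]; split=> // Xz; apply: nH.
- move=> x [Xx _]; apply: (tr F (F `&` `[y0, y1[) y0 x (x + x0)) => //.
  + exact: fF1.1.
  + by move=> z; ring.
  + exact: XF.
- have := tr F (F `&` `[y0, y1[) y0 0 x0 fF fF1.1.
  rewrite /F' (_ : [set z | _ (z - 0 + y0)] = F').
    by apply; [move=> z []|move=> z; ring|exact: XF].
  by apply/seteqP; split=> z /=; rewrite subr0.
- apply: (tr F (F `&` `[y0, y1[) y0 (x1 - x0) x1) => //.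
  + exact: fF1.1.
  + by move=> z; ring.
  + exact: XF.
- have := tr E (E `&` `[x0, x1[) x0 0 y0 fE fE1.1.
  rewrite (_ : [set z | _ (z - 0 + x0)] = E').
    by apply; [move=> z []|move=> z; ring|].
  by apply/seteqP; split=> z /=; rewrite subr0.
- apply: (tr E (E `&` `[x0, x1[) x0 (y1 - y0) y1) => //.
  + exact: fE1.1.
  + by move=> z; ring.
rewrite lE' => h1 h2; split=> //; apply: le_trans h2.
have fEF : fborel (E' `\` F') by apply: fborelD => //; exact: fF'.1.
rewrite -[leRHS](len_shift (- x0) fEF.1).
apply: le_len; [|exact: fborel_shift|].
  by apply: measurableD; [exact: fE1.1|exact: (measurable_shift _ fF.1)].
move=> z [[Ez zi] nF]; split; first by rewrite /E' /= subrK.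
move=> -[Fz _]; apply: nF; move: Fz => /=.
by rewrite (_ : z - x0 + y0 = z + (y0 - x0))//; ring.
Qed.

(** If [E] has the smaller diameter, this is the previous lemma. Otherwise that
    lemma makes [F] nearly an interval and shows that [E] almost contains a
    translate of it; being no longer than [F], the set [E] is almost exhausted by
    this translate. *)
Lemma near_interval_of_sums E F G d : fborel E -> fborel F -> fborel G ->
  0 < d -> 204 * d <= len E -> len E <= len F -> len G <= len E + len F ->
  tri E F (~` G) <= d ^+ 2 ->
  exists u v, v - u <= len E + 143 * d /\ len (E `\` `[u, v]) <= 15 * d.
Proof.
move=> fE fF fG d0 dE EF GEF TEF.
have mG' : measurable (~` G) by apply: measurableC; exact: fG.1.
have [X [mX XE XF lX]] := tri_markov fE fF mG' (ltW d0).
have [Y [mY YF YE lY]] := tri_markov fF fE mG' (ltW d0).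
rewrite -triC// in lY; [|exact: fE.1|exact: fF.1].
have {}lX : len (E `\` X) <= d.
  by rewrite -(ler_pM2r d0) -expr2; exact: le_trans TEF.
have {}lY : len (F `\` Y) <= d.
  by rewrite -(ler_pM2r d0) -expr2; exact: le_trans TEF.
have [|x0 [x1 [Xx0 Xx1 x01 Ex]]] := near_endpoints fE mX XE d0 _ lX; first by lra.
have [|y0 [y1 [Yy0 Yy1 y01 Fy]]] := near_endpoints fF mY YF d0 _ lY; first by lra.
have mi a b : measurable (`[a, b[%classic : set R) by exact: measurable_itv.
have [pq|/ltW qp] := leP (x1 - x0) (y1 - y0).
  have [h _] := full_between_endpoints fE fF fG mX XE d0 dE GEF lX XF Xx0 Xx1 x01
    Ex (YE _ Yy0) (YE _ Yy1) Fy pq.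
  have := lenID fE (mi x0 x1) => lE.
  exists x0, x1; split; first by have := len_ge0 (E `\` `[x0, x1[); lra.
  apply: (@le_trans _ _ (len (E `\` `[x0, x1[))); last by lra.
  apply: le_len; [exact: (fborelD fE (measurable_itv _)).1|exact: fborelD|].
  apply: setDS => z /=; rewrite !in_itv/= => /andP[-> /ltW //].
have dF : 204 * d <= len F by lra.
have GFE : len G <= len F + len E by rewrite addrC.
have [h1 h2] := full_between_endpoints fF fE fG mY YF d0 dF GFE lY YE Yy0 Yy1 y01
  Fy (XF _ Xx0) (XF _ Xx1) Ex qp.
have lF := lenID fF (mi y0 y1).
have fF1 : fborel (F `&` `[y0, y1[) by exact: fborelIl.
have mEs : measurable [set z | E (z + (x0 - y0))].
  exact: measurable_shift fE.1.
have lF1 := lenID fF1 mEs.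
pose q := y1 - y0.
have fE1 : fborel (E `&` `[x0, x0 + q]) by apply: fborelIl => //; exact: measurable_itv.
have le1 : len ((F `&` `[y0, y1[) `&` [set z | E (z + (x0 - y0))]) <=
    len (E `&` `[x0, x0 + q]).
  rewrite -(len_shift (x0 - y0) fE1.1); apply: le_len.
  - exact: (fborelIl fF1 mEs).1.
  - exact: fborel_shift.
  - move=> z [[_ zy] Ez]; split=> //; move: zy.
    rewrite /= !in_itv/= /q => /andP[? ?]; apply/andP; split; lra.
have lE := lenID fE (measurable_itv `[x0, x0 + q]).
have := len_ge0 (E `\` `[x0, x0 + q]).
by exists x0, (x0 + q); rewrite /q in lE le1 *; split; lra.
Qed.

End SmallSumset.

(** * Trimming *)

Section Trimming.
Context {R : realType}.
Implicit Types A B C D E F G H S U V X Y Z : set R.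

(** In [A `&` (z - B)], the piece [D1] removed from the left of [A] and the
    reflection of the piece removed from the right of [B] are both cut out by
    initial segments, one of which contains the other; so only [s1], not twice as
    much, is lost on the left, and likewise [s2] on the right. When [s1 + s2] is
    the excess defined below and the removed pieces have exactly these lengths,
    bounding the trimmed form by the product of the lengths of its first two sets
    gives the Riesz-Sobolev inequality. *)
Lemma tri_trim A B C D1 E1 D2 E2 s1 s2 : fborel A -> fborel B -> fborel C ->
  initial D1 -> initial E1 -> initial D2 -> initial E2 -> 0 <= s1 -> 0 <= s2 ->
  len (A `&` D1) <= s1 -> len (B `\` E2) <= s1 ->
  len (A `\` E1) <= s2 -> len (B `&` D2) <= s2 ->
  tri A B C <= tri ((A `&` E1) `\` D1) ((B `&` E2) `\` D2) C
               + (s1 + s2) * len C.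
Proof.
move=> fA fB fC iD1 iE1 iD2 iE2 s10 s20 AD1 BE2 AE1 BD2.
have mD1 := initial_measurable iD1; have mE1 := initial_measurable iE1.
have mD2 := initial_measurable iD2; have mE2 := initial_measurable iE2.
have fA' : fborel ((A `&` E1) `\` D1) by apply: fborelD => //; exact: fborelIl.
have fB' : fborel ((B `&` E2) `\` D2) by apply: fborelD => //; exact: fborelIl.
apply: tri_le_section => // [|z _]; first exact: addr_ge0.
have fBE2 : fborel (B `\` E2) by exact: fborelD.
have fBD2 : fborel (B `&` D2) by exact: fborelIl.
pose S := A `&` [set x | B (z - x)].
have fS : fborel S by apply: fborelIl => //; exact: measurable_reflect fB.1.
have fS' : fborel (((A `&` E1) `\` D1) `&` [set x | ((B `&` E2) `\` D2) (z - x)]).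
  by apply: fborelIl => //; exact: measurable_reflect fB'.1.
pose P1 := D1 `|` [set x | ~ E2 (z - x)].
pose P2 := ~` E1 `|` [set x | D2 (z - x)].
have mP1 : measurable P1.
  apply: measurableU => //; apply: measurableC; exact: measurable_reflect.
have mP2 : measurable P2.
  by apply: measurableU; [exact: measurableC|exact: measurable_reflect].
have lP1 : len (S `&` P1) <= s1.
  have iQ : initial [set x | ~ E2 (z - x)].
    by move=> x y yx nE2 E2y; apply: nE2; apply: iE2 E2y; rewrite lerB.
  have [D1Q|QD1] := initial_total iD1 iQ.
    apply: le_trans BE2; rewrite -[leRHS](len_reflect z fBE2.1).
    apply: le_len; [exact: (fborelIl fS mP1).1|exact: fborel_reflect|].
    by move=> x [[_ Bx] [/D1Q|]].
  apply: le_trans AD1; apply: le_len; [exact: (fborelIl fS mP1).1|exact: fborelIl|].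
  by move=> x [[Ax _] [|/QD1]].
have lP2 : len (S `&` P2) <= s2.
  have iQ : initial [set x | ~ D2 (z - x)].
    by move=> x y yx nD2 D2y; apply: nD2; apply: iD2 D2y; rewrite lerB.
  have [EQ|QE] := initial_total iE1 iQ.
    apply: le_trans AE1; apply: le_len; [exact: (fborelIl fS mP2).1|exact: fborelD|].
    by move=> x [[Ax _] [|D2x]] //; split=> // /EQ.
  apply: le_trans BD2; rewrite -[leRHS](len_reflect z fBD2.1).
  apply: le_len; [exact: (fborelIl fS mP2).1|exact: fborel_reflect|].
  move=> x [[_ Bx] [nE1|//]]; split=> //; apply: contrapT => nD2.
  by apply: nE1; exact: QE.
have fP1 : fborel (S `&` P1) by exact: fborelIl.
have fP2 : fborel (S `&` P2) by exact: fborelIl.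
have l12 := lenU_le fP1 fP2.
apply: (@le_trans _ _ (len (((A `&` E1) `\` D1) `&`
    [set x | ((B `&` E2) `\` D2) (z - x)]) + len ((S `&` P1) `|` (S `&` P2)))).
  apply: len_cover => //; [exact: fS.1|exact: fborelU|].
  move=> x Sx; have [P1x|nP1] := pselect (P1 x); first by right; left.
  have [P2x|nP2] := pselect (P2 x); first by right; right.
  left; case: Sx => Ax Bx; split; split.
  - by split=> //; apply: contrapT => nE; apply: nP2; left.
  - by move=> Dx; apply: nP1; left.
  - by split=> //; apply: contrapT => nE; apply: nP1; right.
  - by move=> Dx; apply: nP2; right.
rewrite lerD2l; apply: le_trans l12 _; exact: lerD.
Qed.

Lemma initial_opp D : initial D -> initial [set x : R | ~ D (- x)].
Proof. by move=> iD x y yx nD Dy; apply: nD; apply: iD Dy; rewrite lerN2. Qed.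

(** The form is symmetric up to a reflection, under which the left ends of [A] and
    [C] correspond to opposite ends of the first two sets. *)
Lemma tri_trim_sum A B C D1 E1 D3 E3 s1 s2 : fborel A -> fborel B -> fborel C ->
  initial D1 -> initial E1 -> initial D3 -> initial E3 -> 0 <= s1 -> 0 <= s2 ->
  len (A `&` D1) <= s1 -> len (C `&` D3) <= s1 ->
  len (A `\` E1) <= s2 -> len (C `\` E3) <= s2 ->
  tri A B C <= tri ((A `&` E1) `\` D1) B ((C `&` E3) `\` D3)
               + (s1 + s2) * len B.
Proof.
move=> fA fB fC iD1 iE1 iD3 iE3 s10 s20 AD1 CD3 AE1 CE3.
have mD1 := initial_measurable iD1; have mE1 := initial_measurable iE1.
have mD3 := initial_measurable iD3; have mE3 := initial_measurable iE3.
have mA := fA.1; have mB := fB.1; have mC := fC.1.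
have rot X Y : measurable X -> measurable Y ->
    tri X B Y = tri Y [set x | X (- x)] B.
  by move=> mX mY; rewrite triC// tri_rot//.
have mA' : measurable ((A `&` E1) `\` D1).
  by apply: measurableD => //; exact: measurableI.
have mC' : measurable ((C `&` E3) `\` D3).
  by apply: measurableD => //; exact: measurableI.
rewrite !rot//.
have fA_ : fborel [set x | A (- x)] by exact: fborel_opp.
have := @tri_trim C [set x | A (- x)] B D3 E3 [set x | ~ E1 (- x)]
  [set x | ~ D1 (- x)] s1 s2 fC fA_ fB iD3 iE3 (initial_opp iE1) (initial_opp iD1)
  s10 s20 CD3 _ CE3 _.
have -> : [set x | A (- x)] `&` [set x | ~ D1 (- x)] `\` [set x | ~ E1 (- x)] =
    [set x | ((A `&` E1) `\` D1) (- x)].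
  apply/seteqP; split=> x /=.
    by move=> [[Ax nD] E]; split=> //; split=> //; exact: contrapT.
  by move=> [[Ax Ex] nD]; split.
apply.
  have -> : [set x | A (- x)] `\` [set x | ~ D1 (- x)] = [set x | (A `&` D1) (- x)].
    apply/seteqP; split=> x /= [Ax Dx]; split=> //; exact: contrapT.
  by rewrite len_opp//; exact: measurableI.
have -> : [set x | A (- x)] `&` [set x | ~ E1 (- x)] = [set x | (A `\` E1) (- x)].
  by [].
by rewrite len_opp//; exact: measurableD.
Qed.

Lemma two_cuts A l r : fborel A -> 0 <= l -> 0 <= r -> l + r <= len A ->
  exists D E, [/\ initial D, initial E, len (A `&` D) = l, len (A `\` E) = r &
    len ((A `&` E) `\` D) = len A - l - r].
Proof.
move=> fA l0 r0 lr.
have [|D iD lD] := @initial_cut _ A l fA; first by apply/andP; split; lra.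
have [|E iE lE] := @initial_cut _ A (len A - r) fA; first by apply/andP; split; lra.
have mD := initial_measurable iD; have mE := initial_measurable iE.
have lAE : len (A `\` E) = r by have := lenID fA mE; lra.
exists D, E; split=> //.
have fAE := fborelIl fA mE; have := lenID fAE mD.
have [DE|ED] := initial_total iD iE.
  by rewrite -setIA (setIidr DE); lra.
have : len (A `&` E) <= len (A `&` D).
  by apply: le_len; [exact: fAE.1|exact: fborelIl|exact: setIS].
by rewrite -setIA (setIidl ED) lE lD; lra.
Qed.

(** Trimming outside [[x, y]] (here [X] and [Z] are the half-lines below [x] and
    up to [y]) affects the lengths left of [x] and right of [y] separately. *)
Lemma trim_outside A X Z D E : fborel A -> initial X -> initial Z ->
  initial D -> initial E -> X `<=` Z ->
  len (A `&` D) < len (A `&` X) -> len (A `\` E) < len (A `\` Z) ->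
  len ((A `&` E `\` D) `&` X) = len (A `&` X) - len (A `&` D) /\
  len ((A `&` E `\` D) `\` Z) = len (A `\` Z) - len (A `\` E).
Proof.
move=> fA iX iZ iD iE XZ DX EZ.
have mX := initial_measurable iX; have mZ := initial_measurable iZ.
have mD := initial_measurable iD; have mE := initial_measurable iE.
have DsubX : D `<=` X.
  have [//|XD] := initial_total iD iX; exfalso; move: DX; rewrite ltNge.
  by move=> /negP; apply; apply: le_len;
    [exact: (fborelIl fA mX).1|exact: fborelIl|exact: setIS].
have ZE : Z `<=` E.
  have [//|EsubZ] := initial_total iZ iE; exfalso; move: EZ; rewrite ltNge.
  by move=> /negP; apply; apply: le_len;
    [exact: (fborelD fA mZ).1|exact: fborelD|exact: setDS].
split.
  have := lenID (fborelIl fA mX) mD; rewrite -setIA (setIidr DsubX) => ->.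
  rewrite addrAC subrr add0r; congr len; apply/seteqP; split=> z.
    by move=> [[[Az Ez] nD] Xz].
  by move=> [[Az Xz] nD]; split=> //; split=> //; split=> //; exact/ZE/XZ.
have := lenID (fborelD fA mZ) mE.
have -> : (A `\` Z) `\` E = A `\` E.
  apply/seteqP; split=> z [].
    by move=> [Az _] nE.
  by move=> Az nE; split=> //; split=> // /ZE.
move=> ->; rewrite addrK; congr len; apply/seteqP; split=> z.
  by move=> [[[Az Ez] nD] Xz].
by move=> [[Az Xz] nD]; split=> //; split=> // /DsubX/XZ.
Qed.

(** Half the excess of [len A + len B] over [len C]: the total amount by which
    [A] and [B] have to be trimmed to make [C] as long as both together. *)
Definition excess A B C : R := (len A + len B - len C) / 2.

(** [len A * len B - excess A B C ^+ 2] is the value of the form on centered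
    intervals of the same lengths, when these are admissible. It is symmetric in
    the three lengths. *)
Definition near_extremal A B C (d : R) : Prop :=
  len A * len B - excess A B C ^+ 2 - d ^+ 2 <= tri A B C.

(** When the pieces cut off have exactly the lengths [s1] and [s2], what is left of
    [A] and [B] has lengths [excess A C B] and [excess B C A], and [C] is exactly as
    long as both together, although almost all their sums lie in [C]. *)
Lemma near_extremal_trim A B C D1 E1 D2 E2 s1 s2 d :
  fborel A -> fborel B -> fborel C ->
  initial D1 -> initial E1 -> initial D2 -> initial E2 -> 0 <= s1 -> 0 <= s2 ->
  len (A `&` D1) <= s1 -> len (B `\` E2) <= s1 ->
  len (A `\` E1) <= s2 -> len (B `&` D2) <= s2 ->
  s1 + s2 = excess A B C -> near_extremal A B C d ->
  excess A C B * excess B C A - d ^+ 2 <=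
  tri ((A `&` E1) `\` D1) ((B `&` E2) `\` D2) C.
Proof.
move=> fA fB fC iD1 iE1 iD2 iE2 s10 s20 AD BE AE BD s12 ext.
have := tri_trim fA fB fC iD1 iE1 iD2 iE2 s10 s20 AD BE AE BD.
rewrite s12; move: ext; rewrite /near_extremal.
have -> : excess A C B = len A - excess A B C by rewrite /excess; field.
have -> : excess B C A = len B - excess A B C by rewrite /excess; field.
have -> : len C = len A + len B - 2 * excess A B C by rewrite /excess; field.
nra.
Qed.

Lemma few_holes_in_window A E w d u v x y : fborel A -> fborel E -> E `<=` A ->
  u <= x -> x <= y -> y <= v -> v - u <= len E + w ->
  len (E `\` `[u, v]) <= d -> y - x <= len (A `&` `[x, y]) + (w + d).
Proof.
move=> fA fE EA ux xy yv uv Euv.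
have fuv : fborel (`[u, v]%classic : set R) by exact: fborel_itv.
have fxy : fborel (`[x, y]%classic : set R) by exact: fborel_itv.
have h1 := lenID fE fuv.1.
have h2 := lenID fuv fE.1.
have h3 := lenID fxy fA.1.
have h4 : len (`[x, y]%classic `\` A) <= len (`[u, v]%classic `\` E).
  apply: le_len; [exact: (fborelD fxy fA.1).1|exact: (fborelD fuv fE.1)|].
  move=> z [+ nA]; rewrite /= !in_itv/= => /andP[xz zy]; split.
    by apply/andP; split; [exact: le_trans xz|exact: le_trans yv].
  by move=> /EA.
rewrite setIC len_itv in h2; last by lra.
rewrite setIC len_itv in h3; last by lra.
lra.
Qed.

(** Divides the length [l] to be cut off on the left between two trimmings of total
    lengths [t] and [tb - w]. *)
Lemma split_budget (t tb w l : R) : 0 <= t -> 0 <= l -> l <= t + tb - w ->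
  w <= tb -> exists s1 s2 u1 u2, [/\ [/\ 0 <= s1, 0 <= s2, 0 <= u1 & 0 <= u2],
    s1 + s2 = t, u1 + u2 = tb - w & s1 + u1 = l].
Proof.
move=> t0 l0 lw wtb; have [lt|/ltW tl] := leP l t.
  exists l, (t - l), 0, (tb - w).
  by rewrite !subr_ge0 lexx add0r addr0 addrC subrK.
exists t, 0, (l - t), (tb - w - (l - t)).
by rewrite !subr_ge0 lexx addr0; do !split=> //; lra.
Qed.

(** Two stages of trimming place a window of length [w] anywhere in [A]: trim [A]
    and [B] by their excess, then trim [A] and [C] until [A] has length [w]. What
    is cut off on the left of [A] has any prescribed total length [l]. *)
Lemma window_with_small_sumset A B C d w l X Z : fborel A -> fborel B -> fborel C ->
  near_extremal A B C d -> 0 <= excess A B C ->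
  0 <= w -> w <= excess B C A -> w <= excess A C B ->
  initial X -> initial Z -> X `<=` Z ->
  0 <= l -> l <= len A - w ->
  l < len (A `&` X) -> len A - w - l < len (A `\` Z) ->
  exists E F G, [/\ [/\ fborel E, fborel F & fborel G],
    [/\ E `<=` A, len E = w, len F = excess B C A & len G = len E + len F],
    tri E F (~` G) <= d ^+ 2, len (E `&` X) = len (A `&` X) - l &
    len (E `\` Z) = len (A `\` Z) - (len A - w - l)].
Proof.
move=> fA fB fC ext t0 w0 wa wb iX iZ XZ l0 lw lX rZ.
set t := excess A B C in t0; set ta := excess B C A in wa *.
set tb := excess A C B in wb.
have Ea : len A = t + tb by rewrite /t /tb /excess; field.
have Eb : len B = t + ta by rewrite /t /ta /excess; field.
have Ec : len C = ta + tb by rewrite /tb /ta /excess; field.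
rewrite Ea in lw rZ *.
have [s1 [s2 [u1 [u2 [[s10 s20 u10 u20] s12 u12 su]]]]] := split_budget t0 l0 lw wb.
have [|D1 [E1 [iD1 iE1 lD1 lE1 lA']]] := two_cuts fA s10 s20.
  by rewrite Ea s12; clear - w0 wb; lra.
have [|D2 [E2 [iD2 iE2 lD2 lE2 lB']]] := two_cuts fB s20 s10.
  by rewrite Eb addrC s12; clear - w0 wa; lra.
set A' := A `&` E1 `\` D1 in lA'; set B' := B `&` E2 `\` D2 in lB'.
have mD1 := initial_measurable iD1; have mE1 := initial_measurable iE1.
have mD2 := initial_measurable iD2; have mE2 := initial_measurable iE2.
have fA' : fborel A' by apply: fborelD => //; exact: fborelIl.
have fB' : fborel B' by apply: fborelD => //; exact: fborelIl.
have {}lA' : len A' = tb by rewrite lA' Ea; clear - s12; lra.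
have {}lB' : len B' = ta by rewrite lB' Eb; clear - s12; lra.
have T1 : tb * ta - d ^+ 2 <= tri A' B' C.
  by apply: (near_extremal_trim fA fB fC iD1 iE1 iD2 iE2 s10 s20) => //;
    rewrite ?lD1 ?lE1 ?lD2 ?lE2.
have [||A'X A'Z] := trim_outside fA iX iZ iD1 iE1 XZ.
- by rewrite lD1; apply: le_lt_trans lX; clear - su u10; lra.
- by rewrite lE1; apply: le_lt_trans rZ; clear - su s12 u12 u20; lra.
rewrite -/A' lD1 in A'X; rewrite -/A' lE1 in A'Z.
have [|D3 [E3 [iD3 iE3 lD3 lE3 lA'']]] := two_cuts fA' u10 u20.
  by rewrite lA' u12; clear - w0; lra.
have [|D4 [E4 [iD4 iE4 lD4 lE4 lC']]] := two_cuts fC u10 u20.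
  by rewrite Ec u12; clear - w0 wa; lra.
set A'' := A' `&` E3 `\` D3 in lA''; set C' := C `&` E4 `\` D4 in lC'.
have mD3 := initial_measurable iD3; have mE3 := initial_measurable iE3.
have mD4 := initial_measurable iD4; have mE4 := initial_measurable iE4.
have fA'' : fborel A'' by apply: fborelD => //; exact: fborelIl.
have fC' : fborel C' by apply: fborelD => //; exact: fborelIl.
have {}lA'' : len A'' = w by rewrite lA'' lA'; clear - u12; lra.
have {}lC' : len C' = w + ta by rewrite lC' Ec; clear - u12; lra.
have [||A''X A''Z] := trim_outside fA' iX iZ iD3 iE3 XZ.
- by rewrite lD3 A'X; clear - su lX; lra.
- by rewrite lE3 A'Z; clear - su s12 u12 rZ; lra.
rewrite -/A'' lD3 A'X in A''X; rewrite -/A'' lE3 A'Z in A''Z.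
exists A'', B', C'; split=> //.
- by rewrite lA'' lB'; split=> // z [[[[]]]].
- rewrite tri_setC//; last exact: fC'.1.
  have := @tri_trim_sum A' B' C D3 E3 D4 E4 u1 u2 fA' fB' fC iD3 iE3 iD4 iE4
    u10 u20.
  rewrite lD3 lE3 lD4 lE4 => /(_ (lexx _) (lexx _) (lexx _) (lexx _)).
  rewrite -/A'' -/C' lA'' lB' u12; move: T1; clear; nra.
- by rewrite A''X; clear - su; lra.
- by rewrite A''Z; clear - su s12 u12; lra.
Qed.

(** A window of [A] reaching a little beyond [x] and [y] is nearly an interval,
    by [near_interval_of_sums]. *)
Lemma few_local_holes A B C d w x y : fborel A -> fborel B -> fborel C ->
  0 < d -> near_extremal A B C d -> 0 <= excess A B C ->
  w <= excess B C A -> w <= excess A C B -> 204 * d <= w -> x <= y ->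
  16 * d <= len (A `&` `]-oo, x[) -> 16 * d <= len (A `\` `]-oo, y]) ->
  len (A `&` `[x, y]) <= w - 32 * d ->
  y - x <= len (A `&` `[x, y]) + 158 * d.
Proof.
move=> fA fB fC d0 ext t0 wa wb dw xy lx ly lxy.
pose X : set R := `]-oo, x[%classic; pose Z : set R := `]-oo, y]%classic.
have iX : initial X by move=> a b ba; rewrite /X /= !in_itv/=; exact: le_lt_trans.
have iZ : initial Z by exact: initial_below.
have mX := initial_measurable iX; have mZ := initial_measurable iZ.
have XZ : X `<=` Z.
  by move=> z; rewrite /X /Z /= !in_itv/= => zx; exact: ltW (lt_le_trans zx xy).
have ZX : Z `\` X = `[x, y]%classic.
  apply/seteqP; split=> z; rewrite /X /Z /= !in_itv/=.
    by move=> [zy /negP]; rewrite -leNgt => ->.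
  by move=> /andP[xz zy]; split=> //; apply/negP; rewrite -leNgt.
have lA : len A = len (A `&` X) + len (A `&` `[x, y]) + len (A `\` Z).
  rewrite (lenID fA mZ) (lenID (fborelIl fA mZ) mX).
  by rewrite -setIA (setIidr XZ) -setIDA ZX.
have wA : w <= len A.
  have -> : len A = excess A B C + excess A C B by rewrite /excess; field.
  by clear - t0 wb; lra.
rewrite -/X -/Z in lx ly.
(* At least [16 * d] of [A] is kept on both sides of [[x, y]]. *)
pose l := Num.min (len (A `&` X) - 16 * d) (len A - w).
have l0 : 0 <= l by rewrite le_min !subr_ge0 lx.
have lw : l <= len A - w by rewrite ge_min lexx orbT.
have lX : l <= len (A `&` X) - 16 * d by rewrite ge_min lexx.
have rZ : len A - w - l <= len (A `\` Z) - 16 * d.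
  rewrite /l; have [_|_] := leP (len (A `&` X) - 16 * d) (len A - w).
    by clear - lA lxy; lra.
  by rewrite subrr subr_ge0.
have w0 : 0 <= w by clear - d0 dw; lra.
have [||E [F [G [[fE fF fG] [EA lE lF lG] T EX EZ]]]] :=
  window_with_small_sumset fA fB fC ext t0 w0 wa wb iX iZ XZ l0 lw.
- by clear - lX d0; lra.
- by clear - rZ d0; lra.
have [|||u [v [uv Euv]]] := near_interval_of_sums fE fF fG d0 _ _ _ T.
- by rewrite lE.
- by rewrite lE lF.
- by rewrite lG.
have hit S : measurable S -> 16 * d <= len (E `&` S) -> exists2 z, S z & u <= z <= v.
  move=> mS dS; apply: contrapT => nS.
  have : len (E `&` S) <= len (E `\` `[u, v]).
    apply: le_len; first exact: (fborelIl fE mS).1.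
      by apply: fborelD => //; exact: measurable_itv.
    move=> z [Az Sz]; split=> //; rewrite /= in_itv/= => zuv.
    by apply: nS; exists z.
  by clear - d0 dS Euv; lra.
have [z1 + /andP[uz1 _]] : exists2 z, X z & u <= z <= v.
  by apply: hit => //; rewrite EX; clear - lX; lra.
rewrite /X /= in_itv/= => z1x.
have [z2 + /andP[_ z2v]] : exists2 z, (~` Z) z & u <= z <= v.
  apply: hit; first exact: measurableC.
  by rewrite -setDE EZ; clear - rZ; lra.
rewrite /Z /= in_itv/= => /negP; rewrite -ltNge => yz2.
have -> : 158 * d = 143 * d + 15 * d by ring.
exact: (few_holes_in_window fA fE EA (ltW (le_lt_trans uz1 z1x)) xy
  (ltW (lt_le_trans yz2 z2v)) uv Euv).
Qed.

End Trimming.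

(** * From few holes to an interval *)

Section NearInterval.
Context {R : realType}.
Implicit Types A B C D E F G H S U V X Y Z : set R.

Lemma cut_between A x y s : fborel A -> 0 < s < len (A `&` `[x, y]) ->
  exists z, [/\ x <= z, z <= y, len (A `&` `[x, z]) = s &
    len (A `&` `[z, y]) = len (A `&` `[x, y]) - s].
Proof.
move=> fA sA; have fAxy : fborel (A `&` `[x, y]).
  by apply: fborelIl => //; exact: measurable_itv.
have [z zs] := cut_point fAxy sA.
have /andP[s0 sl] := sA.
have xz : x <= z.
  rewrite leNgt; apply/negP => zx.
  suff : len (A `&` `[x, y] `&` `]-oo, z]) = 0 by rewrite zs => s00; lra.
  rewrite -[RHS](@len0 R); congr len; apply/seteqP; split=> // w [[_ + ]].
  by rewrite /= !in_itv/= => /andP[xw _]; lra.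
have zy : z <= y.
  rewrite leNgt; apply/negP => yz.
  suff : len (A `&` `[x, y] `&` `]-oo, z]) = len (A `&` `[x, y]) by rewrite zs; lra.
  congr len; rewrite setIidl// => w [_]; rewrite /= !in_itv/=.
  by move=> /andP[_ wy]; lra.
exists z; split=> //.
  rewrite -zs -setIA; congr (len (_ `&` _)); apply/seteqP; split=> w.
    rewrite /= !in_itv/= => /andP[xw wz]; split=> //.
    by rewrite xw/=; exact: le_trans zy.
  by rewrite /= !in_itv/= => -[/andP[xw wy] wz]; rewrite xw.
have mz : measurable (`]-oo, z] : set R) by exact: measurable_itv.
have := lenID fAxy mz; rewrite zs => ->; rewrite addrAC subrr add0r.
apply/eqP; rewrite eq_le; apply/andP; split.
  rewrite -[leRHS]add0r -(subrr z) -(@len_itv _ true false z z)//.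
  apply: len_cover.
  - by apply: (fborelIl fA _).1; exact: measurable_itv.
  - exact: fborel_itv.
  - exact: fborelD.
  move=> w [Aw]; rewrite /= !in_itv/= => /andP[zw wy].
  have [wz|zw'] := leP w z; [left; lra|right].
  split; first by split=> //; rewrite /= ?in_itv/=; lra.
  by rewrite /= ?in_itv/= => wz; lra.
apply: le_len; first exact: (fborelD fAxy mz).1.
  by apply: fborelIl => //; exact: measurable_itv.
move=> w [[Aw +] nwz]; rewrite /= !in_itv/= => /andP[xw wy]; split=> //.
rewrite wy andbT; move: nwz; rewrite /= in_itv/= => /negP.
by rewrite -ltNge => /ltW.
Qed.

(** The local bound is added up over consecutive pieces of length [w / 2]. *)
Lemma few_holes A B C d w (n : nat) x y : fborel A -> fborel B -> fborel C ->
  0 < d -> near_extremal A B C d -> 0 <= excess A B C ->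
  w <= excess B C A -> w <= excess A C B -> 204 * d <= w -> x <= y ->
  16 * d <= len (A `&` `]-oo, x[) -> 16 * d <= len (A `\` `]-oo, y]) ->
  len (A `&` `[x, y]) <= n.+1%:R * (w / 2) ->
  y - x <= len (A `&` `[x, y]) + n.+1%:R * (158 * d).
Proof.
move=> fA fB fC d0 ext t0 wa wb dw; elim: n x y => [|n IH] x y xy lx ly lxy.
  have := few_local_holes fA fB fC d0 ext t0 wa wb dw xy lx ly; lra.
have mlt z : measurable (`]-oo, z[ : set R) by exact: measurable_itv.
have mle z : measurable (`]-oo, z] : set R) by exact: measurable_itv.
have nd : 0 <= n.+1%:R * (158 * d) by rewrite mulr_ge0//; lra.
rewrite -[n.+2]addn1 natrD mulrDl mul1r in lxy *.
have [small|big] := leP (len (A `&` `[x, y])) (w / 2).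
  have := few_local_holes fA fB fC d0 ext t0 wa wb dw xy lx ly; lra.
have [|z [xz zy xzw zyw]] := @cut_between A x y (w / 2) fA.
  by rewrite big andbT; lra.
have h1 : z - x <= len (A `&` `[x, z]) + 158 * d.
  apply: (few_local_holes fA fB fC d0 ext t0 wa wb) => //; last by lra.
  apply: le_trans ly _; apply: le_len; first exact: (fborelD fA (mle y)).1.
    exact: fborelD.
  by apply: setDS => u; rewrite /= !in_itv/= => uz; exact: le_trans zy.
have h2 : y - z <= len (A `&` `[z, y]) + n.+1%:R * (158 * d).
  apply: IH => //; last by lra.
  apply: le_trans lx _; apply: le_len; first exact: (fborelIl fA (mlt x)).1.
    exact: fborelIl.
  by apply: setIS => u; rewrite /= !in_itv/= => ux; exact: lt_le_trans xz.
lra.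
Qed.

(** The infimum of the points with more than [c] of [A] below them. *)
Lemma left_end A c lb : fborel A -> 0 <= c < len A ->
  (forall x, c < len (A `&` `]-oo, x[) -> lb <= x) ->
  exists u, len (A `&` `]-oo, u[) <= c /\
    forall e, 0 < e -> exists2 x, x < u + e & c < len (A `&` `]-oo, x[).
Proof.
move=> fA /andP[c0 cA] lbP.
have mlt z : measurable (`]-oo, z[ : set R) by exact: measurable_itv.
have mle z : measurable (`]-oo, z] : set R) by exact: measurable_itv.
pose P := [set x | c < len (A `&` `]-oo, x[)].
have below x y S : fborel S -> x < y -> len (S `&` `]-oo, x]) <= len (S `&` `]-oo, y[).
  move=> fS xy; apply: le_len; first exact: (fborelIl fS (mle x)).1.
    exact: fborelIl.
  by apply: setIS => u; rewrite /= !in_itv/= => ux; exact: le_lt_trans xy.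
have P0 : P !=set0.
  have [|x xs] := @cut_point _ A ((c + len A) / 2) fA.
    by apply/andP; split; lra.
  exists (x + 1); rewrite /P /=; apply: (@lt_le_trans _ _ ((c + len A) / 2)).
    by lra.
  by rewrite -xs; apply: below => //; rewrite ltrDl.
have iP : has_inf P by split=> //; exists lb.
exists (inf P); split; last first.
  move=> e e0; have [x Px xe] := inf_adherent e0 iP.
  by exists x.
rewrite leNgt; apply/negP => cu.
have fAu := fborelIl fA (mlt (inf P)).
set S := (A `&` `]-oo, (inf P)[) in cu fAu.
have [|z zs] := @cut_point _ S ((c + len S) / 2) fAu.
  by apply/andP; split; lra.
have zu : z < inf P.
  rewrite ltNge; apply/negP => uz.
  suff : len (S `&` `]-oo, z]) = len S by rewrite zs; lra.
  congr len; rewrite setIidl// => w [_]; rewrite /= !in_itv/=.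
  by move=> /ltW /le_trans; apply.
pose x := (z + inf P) / 2.
have : inf P <= x.
  apply: ge_inf; first exact: iP.2.
  rewrite /P /=; apply: (@lt_le_trans _ _ ((c + len S) / 2)); first by lra.
  rewrite -zs; apply: le_trans (below z x S fAu _) _; first by rewrite /x; lra.
  apply: le_len; first exact: (fborelIl fAu (mlt x)).1.
    exact: fborelIl.
  by apply: setSI => w [].
by rewrite /x; lra.
Qed.

Lemma len_opp_below A x : measurable A ->
  len ([set z | A (- z)] `&` `]-oo, x[) = len (A `\` `]-oo, - x]).
Proof.
move=> mA; rewrite -[RHS]len_opp; last first.
  by apply: measurableD => //; exact: measurable_itv.
congr len; apply/seteqP; split=> z [Az]; rewrite /= ?in_itv/= => h.
  by split=> //; rewrite /= ?in_itv/= => h'; lra.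
split=> //; rewrite /= ?in_itv/=; move/negP: h; lra.
Qed.

(** The interval is spanned by the points that have more than [16 * d0] of [A] on
    either side. The hypothesis concerns [d > d0] only, so that [d0 = 0] is
    included: the interval then contains almost every point of [A]. *)
Lemma near_interval_of_few_holes A h d0 d1 : fborel A -> 0 <= h -> 0 <= d0 ->
  d0 < d1 -> 32 * d1 < len A ->
  (forall d x y, d0 < d <= d1 -> x <= y ->
     16 * d <= len (A `&` `]-oo, x[) -> 16 * d <= len (A `\` `]-oo, y]) ->
     y - x <= len (A `&` `[x, y]) + h * d) ->
  exists u v, [/\ u <= v, v - u <= len A + h * d0 &
    len (A `\` `[u, v]) <= 32 * d0].
Proof.
move=> fA h0 d00 d01 dA holes.
have mlt z : measurable (`]-oo, z[ : set R) by exact: measurable_itv.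
have mle z : measurable (`]-oo, z] : set R) by exact: measurable_itv.
have PQ x y : 16 * d0 < len (A `&` `]-oo, x[) -> 16 * d0 < len (A `\` `]-oo, y]) ->
    y - x <= len A + h * d0.
  move=> lx ly; have A0 := len_ge0 A.
  have hd : 0 <= h * d0 by exact: mulr_ge0.
  have [xy|/ltW yx] := leP x y; last by lra.
  apply/ler_addgt0Pr => e e0.
  pose d := Num.min (Num.min d1 (d0 + e / (h + 1)))
    (Num.min (len (A `&` `]-oo, x[) / 16) (len (A `\` `]-oo, y]) / 16)).
  have eh : 0 < e / (h + 1) by apply: divr_gt0 => //; lra.
  have dd0 : d0 < d by rewrite !lt_min; repeat (apply/andP; split); lra.
  have dd1 : d <= d1 by rewrite !ge_min lexx.
  have ddx : 16 * d <= len (A `&` `]-oo, x[).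
    suff : d <= len (A `&` `]-oo, x[) / 16 by lra.
    by rewrite !ge_min lexx !orbT.
  have ddy : 16 * d <= len (A `\` `]-oo, y]).
    suff : d <= len (A `\` `]-oo, y]) / 16 by lra.
    by rewrite !ge_min lexx !orbT.
  have dde : h * d <= h * d0 + e.
    have : d <= d0 + e / (h + 1) by rewrite !ge_min lexx !orbT.
    move=> /(ler_wpM2l h0) /le_trans; apply; rewrite mulrDr lerD2l.
    by rewrite mulrCA ler_piMr ?(ltW e0)// ler_pdivrMr; lra.
  have d01' : d0 < d <= d1 by rewrite dd0.
  have := holes d x y d01' xy ddx ddy.
  have : len (A `&` `[x, y]) <= len A.
    have mxy : measurable (`[x, y] : set R) by exact: measurable_itv.
    by apply: (le_len (fborelIl fA mxy).1 fA) => z [].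
  lra.
have c0 : 0 <= 16 * d0 < len A by apply/andP; split; lra.
have [y ys] : exists y, 16 * d0 < len (A `\` `]-oo, y]).
  have [|y ys] := @cut_point _ A ((len A - 16 * d0) / 2) fA.
    by apply/andP; split; lra.
  by exists y; have := lenID fA (mle y); lra.
have [x xs] : exists x, 16 * d0 < len (A `&` `]-oo, x[).
  have [|x xs] := @cut_point _ A ((len A + 16 * d0) / 2) fA.
    by apply/andP; split; lra.
  exists (x + 1); apply: (@lt_le_trans _ _ (len (A `&` `]-oo, x]))); first by lra.
  apply: le_len; [exact: (fborelIl fA (mle x)).1|exact: fborelIl|].
  by apply: setIS => z; rewrite /= !in_itv/= => zx; lra.
have [|u [uA uP]] := @left_end A (16 * d0) (y - (len A + h * d0)) fA c0.
  by move=> z zs; have := PQ _ _ zs ys; lra.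
have fA_ : fborel [set z | A (- z)] by exact: fborel_opp.
have [||v [vA vP]] := @left_end _ (16 * d0) (- x - (len A + h * d0)) fA_.
- by rewrite len_opp//; exact: fA.1.
- move=> z; rewrite len_opp_below; last exact: fA.1.
  by move=> zs; have := PQ _ _ xs zs; lra.
rewrite len_opp_below in vA; last exact: fA.1.
exists u, (- v); split.
- rewrite leNgt; apply/negP => vu.
  have : len A <= len (A `&` `]-oo, u[) + len (A `\` `]-oo, - v]); last by lra.
  apply: len_cover; [exact: fA.1|exact: fborelIl|exact: fborelD|].
  move=> z Az; have [zu|uz] := ltP z u; [left|right]; split=> //.
  by rewrite /= in_itv/=; apply/negP; rewrite -ltNge; exact: lt_le_trans uz.
- apply/ler_addgt0Pr => e e0; have e20 : 0 < e / 2 by rewrite divr_gt0.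
  have [x' xu xP] := uP _ e20; have [y' yv] := vP _ e20.
  rewrite len_opp_below; last exact: fA.1.
  by move=> yP; have := PQ _ _ xP yP; lra.
have : len (A `\` `[u, - v]) <= len (A `&` `]-oo, u[) + len (A `\` `]-oo, - v]).
  apply: len_cover; [|exact: fborelIl|exact: fborelD|].
    by apply: (fborelD fA _).1; exact: measurable_itv.
  move=> z [Az nz]; have [zu|uz] := ltP z u; [left|right]; split=> //.
  by move=> zv; apply: nz; rewrite /= in_itv/= uz; exact: zv.
lra.
Qed.

End NearInterval.

(** * Alignment of the intervals *)

Section Alignment.
Context {R : realType}.
Implicit Types A B C D E F G H S U V X Y Z : set R.

Lemma len_left_part A E u v s k m : fborel A -> initial E ->
  len (A `\` `[u, v]) <= k -> len (`[u, v]%classic `\` A) <= k ->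
  0 <= s -> 0 <= k -> u <= v -> len A - len (A `\` E) >= m -> u + s <= v ->
  Num.min m (s - k) <= len (A `&` E `&` `]-oo, u + s]).
Proof.
move=> fA iE Auv uvA s0 k0 uv mE usv; have mE' := initial_measurable iE.
have mle z : measurable (`]-oo, z] : set R) by exact: measurable_itv.
rewrite ge_min; have [EZ|ZE] := initial_total iE (@initial_below _ (u + s)).
  by rewrite -setIA (setIidl EZ) (lenID fA mE') addrK in mE *; rewrite mE.
rewrite -setIA (setIidr ZE); apply/orP; right.
have fus : fborel (`[u, u + s]%classic : set R) by exact: fborel_itv.
have := lenID fus fA.1; rewrite len_itv ?lerDl// addrAC subrr add0r => h.
have h1 : len (`[u, u + s]%classic `\` A) <= len (`[u, v]%classic `\` A).
  apply: le_len; [exact: (fborelD fus fA.1).1| |].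
    by apply: fborelD => //; [exact: fborel_itv|exact: fA.1].
  by apply: setSD => z; rewrite /= !in_itv/= => /andP[-> /le_trans]; apply.
have h2 : len (`[u, u + s] `&` A) <= len (A `&` `]-oo, u + s]).
  apply: le_len; [exact: (fborelIl fus fA.1).1|exact: fborelIl|].
  by move=> z []; rewrite /= !in_itv/= => /andP[_ zs] Az; split.
lra.
Qed.

(** Trim [A] and [B] by half their excess at each end. Pairs of points near the
    left ends of the trimmed sets have sums near [uA + uB + excess A B C], and
    almost all of these sums lie in [C], which therefore cannot start much further
    to the right. *)
Lemma left_ends_align A B C k uA vA uB vB uC : fborel A -> fborel B -> fborel C ->
  0 < k -> near_extremal A B C k -> 0 <= excess A B C ->
  10 * k <= excess A C B -> 10 * k <= excess B C A ->
  uA <= vA -> len (A `\` `[uA, vA]) <= k -> len (`[uA, vA]%classic `\` A) <= k ->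
  uB <= vB -> len (B `\` `[uB, vB]) <= k -> len (`[uB, vB]%classic `\` B) <= k ->
  len (C `&` `]-oo, uC[) <= k ->
  uC <= uA + uB + excess A B C + 8 * k.
Proof.
move=> fA fB fC k0 ext t0 tb ta uvA Al Ar uvB Bl Br Cl.
have Ea : len A = excess A B C + excess A C B by rewrite /excess; field.
have Eb : len B = excess A B C + excess B C A by rewrite /excess; field.
set t := excess A B C in t0 Ea Eb *.
have mle z : measurable (`]-oo, z] : set R) by exact: measurable_itv.
have mlt z : measurable (`]-oo, z[ : set R) by exact: measurable_itv.
have width S u v : fborel S -> u <= v -> len (S `\` `[u, v]) <= k -> len S - k <= v - u.
  move=> fS uv Suv; have fuv : fborel (`[u, v]%classic : set R) by exact: fborel_itv.
  have := lenID fS fuv.1.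
  have : len (S `&` `[u, v]) <= len (`[u, v]%classic : set R).
    by apply: (le_len (fborelIl fS fuv.1).1 fuv) => z [].
  by rewrite len_itv//; lra.
have wA := width _ _ _ fA uvA Al; have wB := width _ _ _ fB uvB Bl.
have t20 : 0 <= t / 2 by rewrite divr_ge0.
have [|D1 [E1 [iD1 iE1 lD1 lE1 lA']]] := two_cuts fA t20 t20; first by lra.
have [|D2 [E2 [iD2 iE2 lD2 lE2 lB']]] := two_cuts fB t20 t20; first by lra.
have T := near_extremal_trim fA fB fC iD1 iE1 iD2 iE2 t20 t20.
rewrite lD1 lE1 lD2 lE2 in T.
have {}T := T k (lexx _) (lexx _) (lexx _) (lexx _) (esym (splitr _)) ext.
have {}lA' : len (A `&` E1 `\` D1) = excess A C B by rewrite lA'; lra.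
have {}lB' : len (B `&` E2 `\` D2) = excess B C A by rewrite lB'; lra.
set A' := A `&` E1 `\` D1 in lA' T; set B' := B `&` E2 `\` D2 in lB' T.
have mD1 := initial_measurable iD1; have mE1 := initial_measurable iE1.
have mD2 := initial_measurable iD2; have mE2 := initial_measurable iE2.
have fA' : fborel A' by apply: fborelD => //; exact: fborelIl.
have fB' : fborel B' by apply: fborelD => //; exact: fborelIl.
have mC' : measurable (~` C) by apply: measurableC; exact: fC.1.
have {}T : tri A' B' (~` C) <= k ^+ 2.
  by rewrite tri_setC//; [rewrite lA' lB'; lra|exact: fC.1].
(* After the left trimming by [t / 2] there remains at least [3 * k] below
   [u + t / 2 + 4 * k]. *)
have left S D E u v : fborel S -> initial D -> initial E -> len (S `&` D) = t / 2 ->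
    len (S `\` E) = t / 2 -> u <= v -> len (S `\` `[u, v]) <= k ->
    len (`[u, v]%classic `\` S) <= k -> t + 10 * k <= len S ->
    3 * k <= len ((S `&` E `\` D) `&` `]-oo, u + (t / 2 + 4 * k)]).
  move=> fS iD iE lD lE uv Sl Sr lS.
  have mD := initial_measurable iD; have mE := initial_measurable iE.
  have wS := width _ _ _ fS uv Sl.
  have s0 : 0 <= t / 2 + 4 * k by lra.
  have := @len_left_part S E u v (t / 2 + 4 * k) k (t / 2 + 3 * k) fS iE Sl Sr s0
    (ltW k0) uv.
  have -> : Num.min (t / 2 + 3 * k) (t / 2 + 4 * k - k) = t / 2 + 3 * k.
    have -> : t / 2 + 4 * k - k = t / 2 + 3 * k by ring.
    by rewrite minxx.
  move=> h; have {h} : t / 2 + 3 * k <= len (S `&` E `&` `]-oo, u + (t / 2 + 4 * k)]).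
    by apply: h; lra.
  pose Z : set R := `]-oo, u + (t / 2 + 4 * k)]%classic; rewrite -/Z => h.
  have mZ : measurable Z by exact: mle.
  have fSEZ : fborel (S `&` E `&` Z) by do 2! apply: fborelIl => //.
  have := lenID fSEZ mD.
  have -> : (S `&` E `&` Z) `\` D = (S `&` E `\` D) `&` Z.
    by rewrite !setDE setIAC.
  have : len (S `&` E `&` Z `&` D) <= len (S `&` D).
    apply: le_len (fborelIl fSEZ mD).1 (fborelIl fS mD) _.
    by move=> z [[[Sz _] _] Dz].
  by rewrite lD -/Z; lra.
have lAl := left A D1 E1 uA vA fA iD1 iE1 lD1 lE1 uvA Al Ar.
have lBl := left B D2 E2 uB vB fB iD2 iE2 lD2 lE2 uvB Bl Br.
rewrite -/A' in lAl; rewrite -/B' in lBl.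
set Al' := A' `&` _ in lAl; set Bl' := B' `&` _ in lBl.
have {}lAl : 3 * k <= len Al' by apply: lAl; lra.
have {}lBl : 3 * k <= len Bl' by apply: lBl; lra.
have fAl : fborel Al' by exact: fborelIl.
have fBl : fborel Bl' by exact: fborelIl.
rewrite leNgt; apply/negP => uCbig.
have fCu : fborel (C `&` `]-oo, uC[) by exact: fborelIl.
have h1 : tri Al' Bl' C <= len Al' * k.
  apply: (@le_trans _ _ (tri Al' Bl' (C `&` `]-oo, uC[))).
    apply: tri_mono => //; [exact: fC.1|exact: fCu.1|].
    move=> [x z] /= [Ax Bx Cz]; split=> //; split=> //=.
    rewrite in_itv/=; move: Ax Bx => -[_ +] [_].
    by rewrite /= !in_itv/=; move: uCbig; lra.
  apply: le_trans (tri_le_mulAC fAl fBl fCu) _.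
  by apply: ler_wpM2l => //; exact: len_ge0.
have h2 : tri Al' Bl' (~` C) <= k ^+ 2.
  apply: le_trans T; apply: tri_mono => //.
  by move=> [x z] /= [[Ax _] [Bx _] Cz].
have := tri_setC fAl fBl fC.1.
have : 0 <= (len Al' - 3 * k) * (len Bl' - k).
  by apply: mulr_ge0; clear - lAl lBl k0; lra.
have : 0 <= k * (len Bl' - 3 * k).
  by apply: mulr_ge0; clear - lBl k0; lra.
have : 0 < k * k by exact: mulr_gt0.
rewrite expr2 in h2; clear - h1 h2; nra.
Qed.

End Alignment.

(** * Stability for Borel sets *)

Section BorelStability.
Context {R : realType}.
Implicit Types A B C D E F G H S U V X Y Z : set R.

Lemma near_extremal_mono A B C d d' : 0 <= d -> d <= d' ->
  near_extremal A B C d -> near_extremal A B C d'.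
Proof.
by rewrite /near_extremal => d0 dd'; have := lerXn2r 2 d0 (le_trans d0 dd') dd'; lra.
Qed.

Lemma near_extremalC A B C d : measurable A -> measurable B -> measurable C ->
  near_extremal A B C d -> near_extremal B A C d.
Proof.
move=> mA mB mC; rewrite /near_extremal /excess (triC mA mB mC).
by rewrite (mulrC (len B)) (addrC (len B)).
Qed.

Lemma near_extremal_rot A B C d : measurable A -> measurable B -> measurable C ->
  near_extremal A B C d -> near_extremal C [set y | B (- y)] A d.
Proof.
move=> mA mB mC; rewrite /near_extremal /excess (tri_rot mA mB mC) len_opp//.
move=> h; apply: le_trans h; rewrite lerD2r le_eqVlt; apply/orP; left; apply/eqP.
by field.
Qed.

Definition near_itv A (k u v : R) : Prop :=
  u <= v /\ len (A `\` `[u, v]) + len (`[u, v]%classic `\` A) <= k.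

Lemma near_itv_len A k u v : fborel A -> near_itv A k u v ->
  len A - k <= v - u <= len A + k.
Proof.
move=> fA [uv Auv].
have fuv : fborel (`[u, v]%classic : set R) by exact: fborel_itv.
have h1 := lenID fA fuv.1; have h2 := lenID fuv fA.1.
rewrite setIC len_itv// in h2.
have := len_ge0 (A `\` `[u, v]); have := len_ge0 (`[u, v]%classic `\` A).
by move=> ? ?; apply/andP; split; lra.
Qed.

Lemma near_itv_opp A k u v : fborel A -> near_itv A k u v ->
  near_itv [set x | A (- x)] k (- v) (- u).
Proof.
move=> fA [uv Auv]; split; first by rewrite lerN2.
have fuv : fborel (`[u, v]%classic : set R) by exact: fborel_itv.
have oitv : `[- v, - u]%classic = [set x | `[u, v]%classic (- x)].
  by apply/seteqP; split=> x; rewrite /= !in_itv/= => /andP[? ?]; apply/andP; split; lra.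
rewrite oitv; apply: le_trans Auv.
rewrite -(len_opp (fborelD fA fuv.1).1) -(len_opp (fborelD fuv fA.1).1).
by [].
Qed.

Lemma first_near_itv A B C w M d : fborel A -> fborel B -> fborel C ->
  0 <= d -> 204 * d < w -> near_extremal A B C d -> 0 <= excess A B C ->
  w <= excess B C A -> w <= excess A C B -> len A <= M ->
  exists u v, near_itv A (((2 * M / w + 1) * 158 + 64) * d) u v.
Proof.
move=> fA fB fC d0 dw ext t0 wa wb AM.
have w0 : 0 < w by lra.
have M0 : 0 <= M by apply: le_trans AM; exact: len_ge0.
have q0 : 0 <= 2 * M / w by rewrite divr_ge0 ?(ltW w0)// mulr_ge0.
have Aw : w <= len A.
  have -> : len A = excess A B C + excess A C B by rewrite /excess; field.
  lra.
pose h := (2 * M / w + 1) * 158.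
have h0 : 0 <= h by rewrite /h; lra.
have [|||u [v [uv uvA Auv]]] := @near_interval_of_few_holes _ A h d (w / 204) fA h0 d0.
- by rewrite ltr_pdivlMr//; lra.
- lra.
- move=> d' x y /andP[dd' d'w] xy lx ly.
  have d'0 : 0 < d' by lra.
  have ext' : near_extremal A B C d' by apply: near_extremal_mono ext => //; exact: ltW.
  have dw' : 204 * d' <= w by move: d'w; rewrite ler_pdivlMr//; lra.
  pose n := Num.truncn (2 * M / w).
  have /andP[n1 n2] := truncn_itv q0; rewrite -/n in n1 n2.
  apply: le_trans (few_holes (n := n) fA fB fC d'0 ext' t0 wa wb dw' xy lx ly _) _.
    apply: (@le_trans _ _ M).
      apply: le_trans AM.
      have mxy : measurable (`[x, y] : set R) by exact: measurable_itv.
      by apply: (le_len (fborelIl fA mxy).1 fA) => z [].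
    by move: (ltW n2); rewrite ler_pdivrMr// mulrA; lra.
  rewrite lerD2l /h -[n.+1]addn1 natrD.
  have : 0 <= (2 * M / w - n%:R) * d' by apply: mulr_ge0; lra.
  rewrite mulrBl; nra.
exists u, v; split=> //.
have fuv : fborel (`[u, v]%classic : set R) by exact: fborel_itv.
have h1 := lenID fA fuv.1; have h2 := lenID fuv fA.1.
rewrite setIC len_itv// in h2.
rewrite -/h mulrDl; lra.
Qed.

(** The two inequalities are one statement, applied to [(A, B, C)] and to the
    triple [(C, - B, A)], in which [x + y = z] reads [z - y = x]. *)
Lemma centers_align A B C w k uA vA uB vB uC vC :
  fborel A -> fborel B -> fborel C -> 0 <= k -> 10 * k < w ->
  near_extremal A B C k ->
  w <= excess A B C -> w <= excess B C A -> w <= excess A C B ->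
  near_itv A k uA vA -> near_itv B k uB vB -> near_itv C k uC vC ->
  `|(uA + vA) / 2 + (uB + vB) / 2 - (uC + vC) / 2| <= 11 * k.
Proof.
move=> fA fB fC k0 kw ext wc wa wb nA nB nC.
have fB_ := fborel_opp fB; have nB_ := near_itv_opp fB nB.
have ext_ := near_extremal_rot fA.1 fB.1 fC.1 ext.
have /andP[A1 A2] := near_itv_len fA nA.
have /andP[B1 B2] := near_itv_len fB nB.
have /andP[C1 C2] := near_itv_len fC nC.
have ends S u v : near_itv S k u v -> [/\ u <= v, len (S `\` `[u, v]) <= k &
    len (`[u, v]%classic `\` S) <= k].
  move=> [uv Suv]; split=> //.
    by have := len_ge0 (`[u, v]%classic `\` S); lra.
  by have := len_ge0 (S `\` `[u, v]); lra.
have below S u v : fborel S -> near_itv S k u v -> len (S `&` `]-oo, u[) <= k.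
  move=> fS /ends[_ Suv _]; apply: le_trans Suv; apply: le_len.
  - by apply: (fborelIl fS _).1; exact: measurable_itv.
  - by apply: fborelD => //; exact: measurable_itv.
  - move=> z [Sz]; rewrite /= !in_itv/= => zu; split=> // /andP[uz _].
    by move: zu; rewrite ltNge uz.
have [uvA Al Ar] := ends _ _ _ nA; have [uvB Bl Br] := ends _ _ _ nB.
have [uvC Cl Cr] := ends _ _ _ nC; have [uvB_ Bl_ Br_] := ends _ _ _ nB_.
have Ab := below _ _ _ fA nA; have Cb := below _ _ _ fC nC.
apply/ler_addgt0Pr => e e0.
pose e' := Num.min (e / 20) (w / 10 - k).
have e'0 : 0 < e' by rewrite lt_min; apply/andP; split; lra.
have e'e : e' <= e / 20 by rewrite ge_min lexx.
have e'w : e' <= w / 10 - k by rewrite ge_min lexx orbT.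
have k'0 : 0 < k + e' by exact: ltr_wpDl.
have kk' : k <= k + e' by rewrite lerDl ltW.
have up x : x <= k -> x <= k + e' by move=> /le_trans; apply.
have lB_ : len [set y | B (- y)] = len B by rewrite len_opp//; exact: fB.1.
have E1 : excess C [set y | B (- y)] A = excess B C A.
  by rewrite /excess lB_ (addrC (len C)).
have E2 : excess C A [set y | B (- y)] = excess A C B.
  by rewrite /excess lB_ (addrC (len C)).
have E3 : excess [set y | B (- y)] A C = excess A B C.
  by rewrite /excess lB_ (addrC (len B)).
have h1 : uC <= uA + uB + excess A B C + 8 * (k + e').
  apply: (left_ends_align fA fB fC k'0 (near_extremal_mono k0 kk' ext) _ _ _
    uvA (up _ Al) (up _ Ar) uvB (up _ Bl) (up _ Br) (up _ Cb)); clear - wc wa wb kw k0 e'w; lra.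
have h2 : uA <= uC + - vB + excess C [set y | B (- y)] A + 8 * (k + e').
  apply: (left_ends_align fC fB_ fA k'0 (near_extremal_mono k0 kk' ext_) _ _ _
    uvC (up _ Cl) (up _ Cr) uvB_ (up _ Bl_) (up _ Br_) (up _ Ab));
  rewrite ?E1 ?E2 ?E3; clear - wc wa wb kw k0 e'w; lra.
rewrite E1 in h2.
have ta : excess B C A = len B - excess A B C by rewrite /excess; field.
have tc : excess A B C = (len A + len B - len C) / 2 by [].
by rewrite ler_norml; apply/andP; split;
  clear - h1 h2 ta tc A1 A2 B1 B2 C1 C2 k0 e'e e0; lra.
Qed.

(** The three sets play symmetric roles: [first_near_itv] is applied to [(A, B, C)],
    [(B, A, C)] and [(C, - B, A)]. Windows of length [w = eta * M / 2] fit into all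
    trimmings, and their number, of order [1 / eta], multiplies the error. *)
Lemma borel_stability A B C eta M d : fborel A -> fborel B -> fborel C ->
  0 < eta -> eta <= 1 -> 0 < M -> 0 <= d ->
  10 * (1000 / eta * d) < eta * M / 2 ->
  near_extremal A B C d -> len A <= M -> len B <= M -> len C <= M ->
  eta * M / 2 <= excess A B C -> eta * M / 2 <= excess B C A ->
  eta * M / 2 <= excess A C B ->
  exists uA vA uB vB uC vC, [/\ near_itv A (1000 / eta * d) uA vA,
    near_itv B (1000 / eta * d) uB vB, near_itv C (1000 / eta * d) uC vC &
    `|(uA + vA) / 2 + (uB + vB) / 2 - (uC + vC) / 2| <= 11 * (1000 / eta * d)].
Proof.
move=> fA fB fC eta0 eta1 M0 d0 dM ext AM BM CM tc ta tb.
set w := eta * M / 2 in tc ta tb.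
have w0 : 0 < w by rewrite divr_gt0// mulr_gt0.
have i1 : 1 <= eta^-1 by rewrite invf_ge1.
set k := 1000 / eta * d in dM *.
have dk : 204 * d <= k by apply: ler_wpM2r => //; clear - i1; lra.
have k0 : 0 <= k by apply: le_trans dk; clear - d0; lra.
rewrite -/w in dM.
have dw : 204 * d < w by apply: le_lt_trans dk _; clear - dM k0; lra.
have ratio : (2 * M / w + 1) * 158 + 64 <= 1000 / eta.
  have -> : 2 * M / w = 4 / eta by rewrite /w; field; rewrite !gt_eqF.
  by clear - i1; lra.
have weaken S u v : near_itv S (((2 * M / w + 1) * 158 + 64) * d) u v ->
    near_itv S k u v.
  by move=> [uv /le_trans h]; split=> //; apply: h; exact: ler_wpM2r.
have lB_ : len [set y | B (- y)] = len B by rewrite len_opp//; exact: fB.1.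
have E1 : excess C [set y | B (- y)] A = excess B C A.
  by rewrite /excess lB_ (addrC (len C)).
have E2 : excess C A [set y | B (- y)] = excess A C B.
  by rewrite /excess lB_ (addrC (len C)).
have E3 : excess [set y | B (- y)] A C = excess A B C.
  by rewrite /excess lB_ (addrC (len B)).
have E4 : excess B A C = excess A B C by rewrite /excess (addrC (len B)).
have [|uA [vA nA]] := first_near_itv fA fB fC d0 dw ext _ ta tb AM.
  by clear - w0 tc; lra.
have extB := near_extremalC fA.1 fB.1 fC.1 ext.
have [|uB [vB nB]] := first_near_itv fB fA fC d0 dw extB _ tb ta BM.
  by rewrite E4; clear - w0 tc; lra.
have extC := near_extremal_rot fA.1 fB.1 fC.1 ext.
have [|||uC [vC nC]] := @first_near_itv C [set y | B (- y)] A w M d fC (fborel_opp fB) fA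
  d0 dw extC _ _ _ CM.
- by rewrite E1; clear - w0 ta; lra.
- by rewrite E3.
- by rewrite E2.
have {}nA := weaken _ _ _ nA; have {}nB := weaken _ _ _ nB.
have {}nC := weaken _ _ _ nC.
exists uA, vA, uB, vB, uC, vC; split=> //.
apply: (centers_align (w := w) fA fB fC) => //.
apply: near_extremal_mono ext => //; apply: le_trans dk.
by clear - d0; lra.
Qed.

End BorelStability.

(** * Lebesgue measurable sets and the extremal intervals *)

Section LebesgueSets.
Context {R : realType}.
Implicit Types A B C D E F G H N S U V X Y Z : set R.
Local Notation mu := (@lebesgue_measure R).
Local Notation cmu := (@completed_lebesgue_measure R).

Lemma le_leb S X : S `<=` X -> (leb S <= leb X)%E.
Proof.
exact: (le_outer_measure ((wlength (idfun : R -> R))^*)%mu).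
Qed.

Lemma leb_borel X : leb X = mu X.
Proof. by []. Qed.

(** Replacing a Lebesgue measurable set by a Borel subset of full measure changes
    no convolution and no length, and makes the plane sets behind the trilinear
    form measurable for the product sigma-algebra. *)
Definition borel_kernel S S0 N : Prop :=
  [/\ measurable S0, measurable N, mu N = 0%E, S0 `<=` S & S `<=` S0 `|` N].

Lemma borel_kernel_exists S : lebesgue_measurable S ->
  exists S0 N, borel_kernel S S0 N.
Proof.
rewrite /lebesgue_measurable -completed_caratheodory_measurable.
rewrite g_sigma_completed_algebra_genE => -[S0 mS0 [N0 [N [mN N_0 N0N]]] <-].
exists S0, N; split=> //.
by move=> x [|/N0N]; [left|right].
Qed.

Lemma borel_kernel_id X : measurable X -> borel_kernel X X set0.
Proof. by move=> mX; split. Qed.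

Lemma borel_kernel_measurable S S0 N :
  borel_kernel S S0 N -> lebesgue_measurable S.
Proof.
move=> [mS0 mN N0 S0S SN].
rewrite /lebesgue_measurable -completed_caratheodory_measurable.
rewrite g_sigma_completed_algebra_genE; exists S0 => //; exists (S `\` S0).
  by exists N; split=> // x [/SN[]].
by apply/seteqP; split=> [x [/S0S|[]]|x Sx] //; have [?|?] := pselect (S0 x);
  [left|right].
Qed.

Lemma leb_borel_kernel S S0 N : borel_kernel S S0 N -> leb S = mu S0.
Proof.
move=> [mS0 mN N0 S0S SN]; apply/eqP; rewrite eq_le; apply/andP; split.
  apply: (le_trans (le_leb SN)); rewrite leb_borel.
  by have /= -> := @measureU0 _ _ _ mu _ _ mS0 mN N0.
by rewrite -leb_borel; exact: le_leb.
Qed.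

Lemma borel_kernel_section S S0 N X X0 M z :
  borel_kernel S S0 N -> borel_kernel X X0 M ->
  borel_kernel (S `&` [set y | X (z - y)]) (S0 `&` [set y | X0 (z - y)])
    (N `|` [set y | M (z - y)]).
Proof.
move=> [mS0 mN N0 S0S SN] [mX0 mM M0 X0X XM].
have mM' : measurable [set y | M (z - y)] by exact: measurable_reflect.
have M'0 : mu [set y | M (z - y)] = 0%E by rewrite lebesgue_reflect.
split.
- by apply: measurableI => //; exact: measurable_reflect.
- exact: measurableU.
- by have /= -> := @measureU0 _ _ _ mu _ _ mN mM' M'0.
- by move=> y [/S0S ? /X0X ?].
- move=> y [/SN[] ?]; last by right; left.
  by move=> /XM[] ?; [left|right; right].
Qed.

Lemma convolution_indic A A0 NA B B0 NB z :
  borel_kernel A A0 NA -> borel_kernel B B0 NB ->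
  convolution \1_A \1_B z = len (B0 `&` [set y | A0 (z - y)]).
Proof.
move=> kA kB; have kE := borel_kernel_section z kB kA.
have mE := borel_kernel_measurable kE.
rewrite /convolution /Rintegral /len -(leb_borel_kernel kE); congr fine.
transitivity (\int[cmu]_y (\1_(B `&` [set y | A (z - y)%R]) y)%:E)%E; last first.
  by rewrite integral_indic// setIT.
apply: eq_integral => y _.
congr EFin; rewrite !indicE -natrM mulnb; congr (_%:R); congr nat_of_bool.
by rewrite in_setI andbC.
Qed.

Lemma measurable_fun_completed (D : set R) (f : R -> \bar R) :
  lebesgue_measurable D -> measurable_fun setT f ->
  measurable_fun (D : set (caratheodory_type ((wlength (idfun : R -> R))^*)%mu)) f.
Proof.
move=> mD mf _ Y mY; apply: measurableI => //.
apply: sub_caratheodory; rewrite -[X in _ X]setTI; exact: mf.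
Qed.

Lemma integral_completed (D : set R) (f : R -> \bar R) :
  measurable D -> measurable_fun setT f -> (forall x, 0 <= f x)%E ->
  (\int[cmu]_(x in D) f x = \int[mu]_(x in D) f x)%E.
Proof.
move=> mD mf f0; apply/esym.
have mid : measurable_fun [set: caratheodory_type ((wlength (idfun : R -> R))^*)%mu]
    (fun x => (x : measurableTypeR R)).
  move=> _ Y mY; rewrite setTI; exact: sub_caratheodory.
have := @ge0_integral_pushforward _ _ _ _ R _ mid cmu D f mD.
apply; first exact: measurable_funTS.
by move=> x _; exact: f0.
Qed.

Lemma pairing_convolution_indic A A0 NA B B0 NB C C0 NC :
  borel_kernel A A0 NA -> borel_kernel B B0 NB -> borel_kernel C C0 NC ->
  fborel A0 -> fborel B0 ->
  pairing (convolution \1_A \1_B) \1_C = tri A0 B0 C0.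
Proof.
move=> kA kB kC fA0 fB0.
have mC := borel_kernel_measurable kC; have [mC0 mN N0 C0C CN] := kC.
have mA0 := fA0.1; have mB0 := fB0.1.
pose g z := mu (B0 `&` [set y | A0 (z - y)]).
have mg : measurable_fun setT g by exact: measurable_fun_ylen.
rewrite triC// /pairing /Rintegral /tri tri_set_ysection//; congr fine.
rewrite -(@integral_completed C0 g)//.
transitivity (\int[cmu]_(z in C) g z)%E.
  rewrite [RHS]integral_mkcond; apply: eq_integral => z _.
  rewrite (convolution_indic z kA kB) patchE indicE /g.
  case: ifPn => Cz; rewrite ?mulr0// mulr1 -lenE//.
  by apply: fborelIl => //; exact: measurable_reflect.
have mC0' : lebesgue_measurable C0 by exact: sub_caratheodory.
rewrite (@ge0_negligible_integral _ _ _ cmu C (C `\` C0))//.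
- rewrite setDD setIidr//.
- exact: measurableD.
- exact: measurable_fun_completed.
- apply/eqP; rewrite eq_le measure_ge0 andbT.
  apply: (@le_trans _ _ (leb NC)); last by rewrite leb_borel N0.
  by apply: le_leb => z [/CN[]].
Qed.

(** The intervals centered at [0] attain the Riesz-Sobolev bound: removing
    [t / 2] from all ends of the first two shortens every section over the third
    by exactly [t], and leaves sets whose sums all lie in the third. *)
Lemma tri_centered_intervals (a b c : R) :
  let t := (a + b - c) / 2 in 0 <= t -> t <= a -> t <= b ->
  a * b - t ^+ 2 <= tri `]- (a / 2), a / 2[ `]- (b / 2), b / 2[ `]- (c / 2), c / 2[.
Proof.
move=> t t0 ta tb.
have foo x y : fborel (`]x, y[%classic : set R) by exact: fborel_itv.
have cE : c = (a - t) + (b - t) by rewrite /t; field.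
have c0 : 0 <= c by lra.
pose A' : set R := `]- ((a - t) / 2), (a - t) / 2[%classic.
pose B' : set R := `]- ((b - t) / 2), (b - t) / 2[%classic.
pose C : set R := `]- (c / 2), c / 2[%classic.
have [fA' fB' fC] : [/\ fborel A', fborel B' & fborel C] by split; exact: foo.
have lC : len C = c by rewrite len_itv; lra.
have lA' : len A' = a - t by rewrite len_itv; lra.
have lB' : len B' = b - t by rewrite len_itv; lra.
have h : tri A' B' C + t * len C <= tri `]- (a / 2), a / 2[ `]- (b / 2), b / 2[ C.
  apply: tri_ge_section => // z; rewrite {1}/C /= in_itv/= => /andP[z1 z2].
  pose l := Num.max (- (a / 2)) (z - b / 2).
  pose r := Num.min (a / 2) (z + b / 2).
  have lr : t <= r - l.
    rewrite /l /r; have [_|_] := leP (- (a / 2)) (z - b / 2);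
      have [_|_] := leP (a / 2) (z + b / 2); rewrite /t in ta tb *; lra.
  have -> : `]- (a / 2), a / 2[%classic `&`
      [set x | `]- (b / 2), b / 2[%classic (z - x)] = `]l, r[%classic.
    apply/seteqP; split=> x; rewrite /= !in_itv/= gt_max lt_min.
      by move=> [/andP[? ?] /andP[? ?]]; repeat (apply/andP; split); lra.
    by move=> /andP[/andP[? ?] /andP[? ?]]; split; apply/andP; split; lra.
  have -> : A' `&` [set x | B' (z - x)] = `]l + t / 2, r - t / 2[%classic.
    apply/seteqP; split=> x.
      have E1 : (l + t / 2 < x) = (l < x - t / 2) by rewrite ltrBrDr.
      have E2 : (x < r - t / 2) = (x + t / 2 < r) by rewrite ltrBrDr.
      rewrite /A' /B' /= !in_itv/= E1 E2 /l /r gt_max lt_min.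
      by move=> [/andP[? ?] /andP[? ?]]; repeat (apply/andP; split); lra.
    rewrite /A' /B' /= !in_itv/= -ltrBrDr => /andP[+ xr].
    have {}xr : x + t / 2 < r by rewrite -ltrBrDr.
    move: xr; rewrite /l /r gt_max lt_min => /andP[? ?] /andP[? ?].
    by split; apply/andP; split; lra.
  by rewrite !len_itv; lra.
have h' : (a - t) * (b - t) <= tri A' B' C.
  rewrite -lA' -lB' -tri_setT//; apply: tri_mono => //; first exact: fC.1.
  move=> [x z] /= [Ax Bx _]; split=> //; move: Ax Bx.
  rewrite /A' /B' /C /= !in_itv/= => /andP[? ?] /andP[? ?]; apply/andP; split; lra.
apply: le_trans h; rewrite lC; move: h'; rewrite [in t * c]cE.
nra.
Qed.

Lemma leb_setY_le A A0 N X k : borel_kernel A A0 N -> fborel A0 -> fborel X ->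
  len (A0 `\` X) + len (X `\` A0) <= k -> (leb (A `+` X) <= k%:E)%E.
Proof.
move=> [mA0 mN N0 A0A AN] fA0 fX kX.
have fD : fborel (A0 `\` X) by exact: fborelD fA0 fX.1.
have fD' : fborel (X `\` A0) by exact: fborelD fX fA0.1.
have fU := fborelU fD fD'.
apply: (@le_trans _ _ (leb ((A0 `\` X `|` X `\` A0) `|` N))).
  apply: le_leb => x [[/AN[] Ax nXx]|[Xx nAx]].
  - by left; left.
  - by right.
  - by left; right; split=> // /A0A.
have /= E := @measureU0 _ _ _ mu _ _ fU.1 mN N0.
by rewrite leb_borel E lenE// lee_fin; apply: le_trans kX; exact: lenU_le.
Qed.

Lemma bounded_interval_itvcc (u v : R) : u <= v -> bounded_interval `[u, v].
Proof.
move=> uv; have uI : `[u, v]%classic u by rewrite /= in_itv/= lexx.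
split.
- exact: interval_is_interval.
- split; first by exists u.
  by exists u => x; rewrite /= in_itv/= => /andP[].
- split; first by exists u.
  by exists v => x; rewrite /= in_itv/= => /andP[].
Qed.

Lemma interval_center_itvcc (u v : R) : u <= v ->
  interval_center `[u, v] = (u + v) / 2.
Proof. by move=> uv; rewrite /interval_center inf_itvcc ?sup_itvcc. Qed.

End LebesgueSets.

(** * Stability of the Riesz-Sobolev inequality *)

Theorem theorem2p1 (R : realType) :
  exists K : R, 0 < K /\
  forall (eta eps : R) (A B C : set R),
    0 < eta -> eta <= 1 -> 0 <= eps ->
    lebesgue_measurable A -> lebesgue_measurable B -> lebesgue_measurable C ->
    (0 < leb A < +oo)%E -> (0 < leb B < +oo)%E -> (0 < leb C < +oo)%E ->
    strictly_admissible eta A B C ->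
    pairing (convolution \1_(sym_interval A) \1_(sym_interval B)) \1_(sym_interval C)
        - eps * max_rleb A B C ^+ 2
      <= pairing (convolution \1_A \1_B) \1_C ->
    eps <= K^-1 * eta ^+ 4 ->
    exists I J L : set R,
      [/\ bounded_interval I, bounded_interval J & bounded_interval L] /\
      [/\ (leb (A `+` I) <=
             (K * eta^-1 * eps `^ (1 / 2) * max_rleb A B C)%:E)%E,
          (leb (B `+` J) <=
             (K * eta^-1 * eps `^ (1 / 2) * max_rleb A B C)%:E)%E,
          (leb (C `+` L) <=
             (K * eta^-1 * eps `^ (1 / 2) * max_rleb A B C)%:E)%E &
          `|interval_center I + interval_center J - interval_center L|
            <= K * eta ^- 2 * eps `^ (1 / 4) * max_rleb A B C].

Proof.
exists (10 ^+ 10); split; first by rewrite exprn_gt0.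
move=> eta eps A B C eta0 eta1 eps0 LA LB LC /andP[A0 Ay] /andP[B0 By] /andP[C0 Cy].
move=> adm hT heps.
have [A1 [NA kA]] := borel_kernel_exists LA.
have [B1 [NB kB]] := borel_kernel_exists LB.
have [C1 [NC kC]] := borel_kernel_exists LC.
rewrite (leb_borel_kernel kA) in A0 Ay; rewrite (leb_borel_kernel kB) in B0 By.
rewrite (leb_borel_kernel kC) in C0 Cy.
have fA : fborel A1 by split=> //; have [] := kA.
have fB : fborel B1 by split=> //; have [] := kB.
have fC : fborel C1 by split=> //; have [] := kC.
have rA : rleb A = len A1 by rewrite /rleb (leb_borel_kernel kA).
have rB : rleb B = len B1 by rewrite /rleb (leb_borel_kernel kB).
have rC : rleb C = len C1 by rewrite /rleb (leb_borel_kernel kC).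
set M := max_rleb A B C in adm hT *.
have [AM BM CM] : [/\ len A1 <= M, len B1 <= M & len C1 <= M].
  by rewrite /M /max_rleb rA rB rC; split; rewrite !le_max lexx ?orbT.
have M0 : 0 < M.
  by apply: lt_le_trans AM; rewrite -lte_fin -lenE.
have [tc ta tb] : [/\ eta * M / 2 <= excess A1 B1 C1,
    eta * M / 2 <= excess B1 C1 A1 & eta * M / 2 <= excess A1 C1 B1].
  have := adm (@Ordinal 3 0 isT) (@Ordinal 3 1 isT) (@Ordinal 3 2 isT) isT.
  have := adm (@Ordinal 3 1 isT) (@Ordinal 3 2 isT) (@Ordinal 3 0 isT) isT.
  have := adm (@Ordinal 3 0 isT) (@Ordinal 3 2 isT) (@Ordinal 3 1 isT) isT.
  rewrite !(tnth_nth set0) /= -/M rA rB rC /excess => h1 h2 h3.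
  by split; rewrite ler_pM2r// lerBrDl.
pose r := eps `^ (1 / 2); pose r4 := eps `^ (1 / 4).
have r0 : 0 <= r by exact: powR_ge0.
have r40 : 0 <= r4 by exact: powR_ge0.
have rr : r ^+ 2 = eps.
  by rewrite /r -powR_mulrn// -powRrM mul1r mulVf// powRr1.
have r4r : r4 ^+ 2 = r.
  rewrite /r4 -powR_mulrn// -powRrM /r; congr (_ `^ _).
  by field.
(* The constant is [(10 ^+ 5) ^+ 2]; [r] is the square root of [eps]. *)
have r_le : 10 ^+ 5 * r <= eta ^+ 2.
  rewrite -(@ler_pXn2r _ 2)// ?nnegrE ?mulr_ge0 ?exprn_ge0 ?(ltW eta0)//.
  rewrite exprMn rr -!exprM mulnC [(2 * 2)%N]/= (_ : (2 * 5 = 10)%N)//.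
  by rewrite -ler_pdivlMl// exprn_gt0.
have r1 : r <= 1.
  have : eta ^+ 2 <= 1 by rewrite expr_le1// ltW.
  have : r <= 10 ^+ 5 * r by rewrite ler_peMl// exprn_ege1// ler1n.
  lra.
have r4_le1 : r4 <= 1 by rewrite -(@ler_pXn2r _ 2)// ?nnegrE// r4r expr1n.
have rr4 : r <= r4 by rewrite -r4r expr2 ler_piMl.
pose d := r * M.
have d0 : 0 <= d by rewrite mulr_ge0// ltW.
have etaM0 : 0 < eta * M by exact: mulr_gt0.
have dM : 10 * (1000 / eta * d) < eta * M / 2.
  have -> : 10 * (1000 / eta * d) = (10 ^+ 4 * r) * M / eta.
    by rewrite /d !exprS expr0; field; rewrite gt_eqF.
  rewrite ltr_pdivrMr//; set y := 10 ^+ 4 * r.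
  have y_le : 10 * y <= eta ^+ 2 by rewrite /y mulrA -exprS.
  have : 10 * y * M <= eta ^+ 2 * M by rewrite ler_pM2r.
  have : 0 < eta * M * eta by exact: mulr_gt0.
  by clear; rewrite expr2; nra.
have ext : near_extremal A1 B1 C1 d.
  have kI (S : set R) : borel_kernel (sym_interval S) (sym_interval S) set0.
    by apply: borel_kernel_id; exact: measurable_itv.
  have fI (S : set R) : fborel (sym_interval S) by exact: fborel_itv.
  rewrite (pairing_convolution_indic (kI A) (kI B) (kI C))// in hT.
  rewrite (pairing_convolution_indic kA kB kC)// in hT.
  rewrite /near_extremal; apply: le_trans hT.
  have -> : d ^+ 2 = eps * M ^+ 2 by rewrite /d exprMn rr.
  rewrite lerD2r /sym_interval rA rB rC /excess.
  apply: tri_centered_intervals.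
  - by apply: le_trans tc; rewrite divr_ge0// ltW.
  - by move: tb etaM0; rewrite /excess; clear; lra.
  - by move: ta etaM0; rewrite /excess; clear; lra.
have [uA [vA [uB [vB [uC [vC [nA nB nC cABC]]]]]]] :=
  borel_stability fA fB fC eta0 eta1 M0 d0 dM ext AM BM CM tc ta tb.
have K_ge : 11 * 1000 <= 10 ^+ 10 :> R by rewrite !exprS expr0; clear; lra.
(* The value of the constant is hidden from conversion. *)
move: K_ge; generalize (10 ^+ 10 : R) => K K_ge.
have etaV0 : 0 <= eta^-1 by rewrite invr_ge0 ltW.
have kK : 1000 / eta * d <= K * eta^-1 * r * M.
  rewrite /d mulrA; apply: ler_wpM2r; first exact: ltW.
  apply: ler_wpM2r => //; apply: ler_wpM2r => //; move: K_ge; clear; lra.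
have fitv u v : fborel (`[u, v]%classic : set R) by exact: fborel_itv.
exists `[uA, vA]%classic, `[uB, vB]%classic, `[uC, vC]%classic; split.
  by split; apply: bounded_interval_itvcc; [exact: nA.1|exact: nB.1|exact: nC.1].
split.
- exact: (leb_setY_le kA fA (fitv _ _) (le_trans nA.2 kK)).
- exact: (leb_setY_le kB fB (fitv _ _) (le_trans nB.2 kK)).
- exact: (leb_setY_le kC fC (fitv _ _) (le_trans nC.2 kK)).
rewrite !interval_center_itvcc; [|exact: nC.1|exact: nB.1|exact: nA.1].
apply: le_trans cABC _.
have [N [N0 NK ->]] : exists N,
    [/\ 0 <= N, N <= K & 11 * (1000 / eta * d) = N * eta^-1 * r * M].
  by exists (11 * 1000); split; [clear; lra|exact: K_ge|rewrite /d !mulrA].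
apply: ler_wpM2r; first exact: ltW.
have eta2 : eta^-1 <= eta ^- 2.
  by rewrite -exprVn expr2 ler_peMl// invf_ge1.
exact: (ler_pM (mulr_ge0 N0 etaV0) r0 (ler_pM N0 etaV0 NK eta2) rr4).
Qed.
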